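(* Let $k>0$ be an integer. Let $\mathcal{M}$ be a $k$-Ahlfors-David regular metric space which has Big Pieces of Lipschitz images of $\mathbb{R}^k$. Then $\mathcal{M}$ has Big Pieces of BiLipschitz images of $\mathbb{R}^k$.
   Context: $\mathcal{H}^k$ denotes $k$-dimensional Hausdorff measure, and $\mathrm{Ball}(x,r)$ the ball of radius $r$ about $x$ in $\mathcal{M}$. A metric space $\mathcal{M}$ is $k$-Ahlfors-David regular if there is a constant $c_0>0$ such that $c_0^{-1}r^k\le\mathcal{H}^k(\mathrm{Ball}(x,r))\le c_0r^k$ for all $x\in\mathcal{M}$ and $0<r<\mathrm{diam}(\mathcal{M})$. A $k$-Ahlfors-David regular metric space $\mathcal{M}$ has Big Pieces of Lipschitz images of $\mathbb{R}^k$ if there are constants $L_1,c_1>0$ such that for every $x\in\mathcal{M}$ and $0<r<\mathrm{diam}(\mathcal{M})$ there are a set $A\subset\mathrm{Ball}_{\mathbb{R}^k}(0,r)$ and an $L_1$-Lipschitz function $f:A\to\mathcal{M}$ with $\mathcal{H}^k(f(A)\cap\mathrm{Ball}(x,r))\ge c_1r^k$. It has Big Pieces of BiLipschitz images of $\mathbb{R}^k$ if there are constants $L_2,c_2>0$ such that for every $x\in\mathcal{M}$ and $0<r<\mathrm{diam}(\mathcal{M})$ there are a set $A\subset\mathrm{Ball}_{\mathbb{R}^k}(0,r)$ and an $L_2$-BiLipschitz function $f:A\to\mathcal{M}$ (i.e. $L_2^{-1}|u-v|\le\mathrm{dist}(f(u),f(v))\le L_2|u-v|$ for $u,v\in A$)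 with $\mathcal{H}^k(f(A)\cap\mathrm{Ball}(x,r))\ge c_2r^k$. *)

(* Defs.v *)
From mathcomp Require Import all_boot all_order all_algebra.
From mathcomp Require Import all_classical all_reals all_analysis.
Set Implicit Arguments.
Unset Strict Implicit.
Unset Printing Implicit Defensive.
Import Order.TTheory GRing.Theory Num.Theory.
Local Open Scope classical_set_scope.
Local Open Scope ring_scope.

(* The point 0 is adjoined so that the empty set has diameter 0
   (the supremum of the empty set in \bar R is -oo). *)
Definition diam (R : realType) (M : metricType R) (A : set M) : \bar R :=
  ereal_sup (0%E |` [set (mdist p.1 p.2)%:E | p in A `*` A]).

(* The power is k-fold multiplication in \bar R. For k = 0 the empty set would
   contribute 1 instead of 0, so this is the Hausdorff measure for 0 < k.
   No normalizing constant is included. *)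
Definition hausdorff_premeasure (R : realType) (M : metricType R) (k : nat)
    (delta : R) (A : set M) : \bar R :=
  ereal_inf [set (\sum_(0 <= i <oo) diam (U i) ^+ k)%E | U in
    [set U : nat -> set M |
      A `<=` \bigcup_i U i /\ forall i, (diam (U i) <= delta%:E)%E]].

Definition hausdorff_measure (R : realType) (M : metricType R) (k : nat)
    (A : set M) : \bar R :=
  ereal_sup [set hausdorff_premeasure k delta A | delta in
    [set delta : R | 0 < delta]].

(* The library norm on row vectors is the sup norm, whence this one. *)
Definition euclidean_norm (R : realType) (k : nat) (v : 'rV[R]_k) : R :=
  Num.sqrt (\sum_(i < k) v ord0 i ^+ 2).

Definition euclidean_ball (R : realType) (k : nat) (c : 'rV[R]_k) (r : R) :
    set 'rV[R]_k :=
  [set u | euclidean_norm (u - c) < r].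

(* In the next two definitions a function A -> M is represented by a total one
   whose values outside A are unconstrained. *)
Definition lipschitz_into (R : realType) (k : nat) (M : metricType R) (L : R)
    (A : set 'rV[R]_k) (f : 'rV[R]_k -> M) : Prop :=
  forall u v, A u -> A v -> mdist (f u) (f v) <= L * euclidean_norm (u - v).

Definition bilipschitz_into (R : realType) (k : nat) (M : metricType R) (L : R)
    (A : set 'rV[R]_k) (f : 'rV[R]_k -> M) : Prop :=
  forall u v, A u -> A v ->
    L^-1 * euclidean_norm (u - v) <= mdist (f u) (f v)
      <= L * euclidean_norm (u - v).

Definition ahlfors_david_regular (R : realType) (k : nat) (M : metricType R) :
    Prop :=
  exists c0 : R, 0 < c0 /\
    forall (x : M) (r : R), 0 < r -> (r%:E < diam [set: M])%E ->
      ((c0^-1 * r ^+ k)%:E <= hausdorff_measure k (ball x r)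
         <= (c0 * r ^+ k)%:E)%E.

Definition big_pieces_lipschitz (R : realType) (k : nat) (M : metricType R) :
    Prop :=
  exists L1 c1 : R, [/\ 0 < L1, 0 < c1 &
    forall (x : M) (r : R), 0 < r -> (r%:E < diam [set: M])%E ->
      exists (A : set 'rV[R]_k) (f : 'rV[R]_k -> M),
        [/\ A `<=` euclidean_ball 0 r,
            lipschitz_into L1 A f &
            ((c1 * r ^+ k)%:E <=
               hausdorff_measure k ((f @` A) `&` ball x r))%E]].

Definition big_pieces_bilipschitz (R : realType) (k : nat) (M : metricType R) :
    Prop :=
  exists L2 c2 : R, [/\ 0 < L2, 0 < c2 &
    forall (x : M) (r : R), 0 < r -> (r%:E < diam [set: M])%E ->
      exists (A : set 'rV[R]_k) (f : 'rV[R]_k -> M),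
        [/\ A `<=` euclidean_ball 0 r,
            bilipschitz_into L2 A f &
            ((c2 * r ^+ k)%:E <=
               hausdorff_measure k ((f @` A) `&` ball x r))%E]].

(* Main.v *)
Require Import Defs.
From HB Require Import structures.
From mathcomp Require Import all_boot all_order all_algebra.
From mathcomp Require Import all_classical all_reals all_analysis.
From mathcomp Require Import ring lra zify.
Set Implicit Arguments.
Unset Strict Implicit.
Unset Printing Implicit Defensive.
Import Order.TTheory GRing.Theory Num.Theory.
Local Open Scope classical_set_scope.
Local Open Scope ring_scope.

(* Pull the metric back along a Lipschitz map [f] defined on part of a cube and
   extend it to a 1-periodic pseudometric [rho] on R^k. For a fixed vector [u],
   the sum of [(2^n rho(p, p + 2^-n u))^2] over a fine grid of the torus is
   bounded and, by convexity and the triangle inequality, nondecreasing in [n];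
   its increments control how far [rho] is, at scale [2^-n], from being affine
   along [u]. Hence, outside a set of small measure, the total roughness of [rho]
   over all scales is bounded at each point. On a dyadic cube where [rho] is
   nearly affine through sufficiently many scales it is almost invariant under
   translation, so if it collapses one pair of points at distance comparable to
   the side then it collapses the whole cube onto a neighbourhood of its
   boundary, and the image has small Hausdorff measure because balls of [M] of
   radius [s] have measure O(s^k). Once all such cubes are removed, [f] can only
   collapse a pair of points at scales where both of them are rough; a finite
   code, reading off the positions of a point at its rough scales, separates such
   pairs, and [f] is biLipschitz on each set of points with the same code. *)

(** * Hausdorff measure *)

Section Hausdorff.
Local Open Scope ereal_scope.
Variables (R : realType) (M : metricType R) (k : nat).
Implicit Types (A : set M) (U : nat -> set M).

Lemma diam_ge0 A : 0 <= diam A.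
Proof. by apply: ereal_sup_ubound; left. Qed.

Lemma diam_set0 : diam (set0 : set M) = 0.
Proof.
apply/eqP; rewrite eq_le diam_ge0 andbT; apply: ge_ereal_sup => x [->//|].
by move=> [p [[]]].
Qed.

Local Notation premeasure := (@hausdorff_premeasure R M k.+1).
Local Notation measure := (@hausdorff_measure R M k.+1).

Lemma premeasure_ge0 d A : 0 <= premeasure d A.
Proof.
apply: le_ereal_inf_tmp => _ [U _ <-]; apply: nneseries_ge0 => n _ _.
by rewrite expe_ge0// diam_ge0.
Qed.

Lemma premeasure_set0 d : (0 < d)%R -> premeasure d set0 = 0.
Proof.
move=> d0; apply/eqP; rewrite eq_le premeasure_ge0 andbT.
apply: ereal_inf_lbound; exists (fun=> set0).
  by split=> [x []|i]; rewrite diam_set0 lee_fin ltW.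
by apply: eseries0 => i _ _; rewrite diam_set0 expeS mul0e.
Qed.

Lemma le_premeasure d A B : A `<=` B -> premeasure d A <= premeasure d B.
Proof.
move=> AB; apply: ereal_inf_le_tmp => _ [U [BU Ud] <-]; exists U => //.
by split => //; exact: subset_trans AB BU.
Qed.

Lemma premeasure_sigma_subadditive d : sigma_subadditive (premeasure d).
Proof.
move=> A; have [[i ioo]|] := pselect (exists i, premeasure d (A i) = +oo).
  rewrite (eseries_pinfty _ _ ioo) ?leey// => n _.
  by rewrite -ltNye (lt_le_trans _ (premeasure_ge0 _ _)).
rewrite -forallNE => Aoo; apply/lee_addgt0Pr => e e0.
apply: le_trans (epsilon_trick xpredT (fun n => premeasure_ge0 d (A n)) (ltW e0)).
have [G PG] : {G : nat -> nat -> set M & forall n,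
    (A n `<=` \bigcup_i G n i /\ forall i, diam (G n i) <= d%:E) /\
    \sum_(i <oo) diam (G n i) ^+ k.+1 <=
      premeasure d (A n) + (e / (2 ^ n.+1)%:R)%:E}.
  apply: (@choice _ _ (fun n G => (A n `<=` \bigcup_i G i /\
      forall i, diam (G i) <= d%:E) /\ \sum_(i <oo) diam (G i) ^+ k.+1 <=
      premeasure d (A n) + (e / (2 ^ n.+1)%:R)%:E)) => n.
  have en : (0 < e / (2 ^ n.+1)%:R)%R by rewrite divr_gt0// ltr0n expn_gt0.
  have fin : premeasure d (A n) \is a fin_num.
    rewrite ge0_fin_numE; last exact: premeasure_ge0.
    by rewrite ltey; apply/eqP; exact: Aoo.
  have [_ [U hU <-] /ltW hsum] := lb_ereal_inf_adherent en fin.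
  by exists U.
have D0 (p : nat * nat) : 0 <= diam (G p.1 p.2) ^+ k.+1 by rewrite expe_ge0// diam_ge0.
have /card_esym/ppcard_eqP[f] := card_nat2.
apply: (@le_trans _ _ (\sum_(i <oo) diam (G (f i).1 (f i).2) ^+ k.+1)).
  apply: ereal_inf_lbound; exists (fun i => G (f i).1 (f i).2) => //.
  split=> [x [n _ Anx]|i]; last exact: (PG _).1.2.
  have [i _ Gx] := (PG n).1.1 _ Anx.
  by exists (f^-1%FUN (n, i)) => //=; rewrite invK ?inE.
rewrite (nneseries_esumT (fun i => D0 (f i))).
have -> : \esum_(i in [set: nat]) diam (G (f i).1 (f i).2) ^+ k.+1 =
    \esum_(p in [set: nat * nat]) diam (G p.1 p.2) ^+ k.+1.
  by apply/esym/(reindex_esum _ _ f (fun p : nat * nat => _)); exact: bij.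
apply: (@le_trans _ _ (\sum_(n <oo) \sum_(i <oo) diam (G n i) ^+ k.+1)); last first.
  apply: lee_nneseries => [n _ _|n _]; last exact: (PG n).2.
  by apply: nneseries_ge0 => i _ _; exact: (D0 (n, i)).
rewrite nneseries_esumT; last first.
  by move=> n; apply: nneseries_ge0 => i _ _; exact: (D0 (n, i)).
rewrite (eq_esum (fun n _ => nneseries_esumT (fun i => D0 (n, i)))) esum_esum//.
  by rewrite (_ : _ `*`` _ = [set: nat * nat])//; apply/seteqP; split.
Qed.

Lemma hausdorff_measure_set0 : measure set0 = 0.
Proof.
apply/eqP; rewrite eq_le; apply/andP; split.
  by apply: ge_ereal_sup => _ [d d0 <-]; rewrite premeasure_set0.
apply: le_trans (premeasure_ge0 1 set0) _.
by apply: ereal_sup_ubound; exists 1%R => //=.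
Qed.

Lemma hausdorff_measure_ge0 A : 0 <= measure A.
Proof.
apply: le_trans (premeasure_ge0 1 A) _.
by apply: ereal_sup_ubound; exists 1%R => //=.
Qed.

Lemma le_hausdorff_measure A B : A `<=` B -> measure A <= measure B.
Proof.
move=> AB; apply: ge_ereal_sup => _ [d d0 <-].
apply: le_trans (le_premeasure d AB) _.
by apply: ereal_sup_ubound; exists d.
Qed.

Lemma hausdorff_measure_sigma_subadditive : sigma_subadditive measure.
Proof.
move=> F; apply: ge_ereal_sup => _ [d d0 <-].
apply: le_trans (premeasure_sigma_subadditive d F) _.
apply: lee_nneseries => [n _ _|n _]; first exact: premeasure_ge0.
by apply: ereal_sup_ubound; exists d.
Qed.

HB.instance Definition _ := isOuterMeasure.Build R M
  (@hausdorff_measure R M k.+1) hausdorff_measure_set0 hausdorff_measure_ge0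
  le_hausdorff_measure hausdorff_measure_sigma_subadditive.

End Hausdorff.

(** * Pullback of an outer measure along a map *)

Section Pullback.
Local Open Scope ereal_scope.
Variables (R : realType) (S M : Type) (mu : {outer_measure set M -> \bar R}).
Variables (A : set S) (g : S -> M).

(** The estimates on the parameter side are stated for an arbitrary outer measure; this is the one
    they are applied to, with Hausdorff measure as [mu]. *)
Definition image_measure (X : set S) : \bar R := mu (g @` (A `&` X)).

Let image_measure0 : image_measure set0 = 0.
Proof. by rewrite /image_measure setI0 image_set0 outer_measure0. Qed.

Let image_measure_ge0 X : 0 <= image_measure X.
Proof. exact: outer_measure_ge0. Qed.

Let le_image_measure : {homo image_measure : X Y / X `<=` Y >-> X <= Y}.
Proof.
move=> X Y XY; apply: le_outer_measure; apply: image_subset; exact: setIS.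
Qed.

Let image_measure_sigma_subadditive : sigma_subadditive image_measure.
Proof.
move=> F; rewrite /image_measure setI_bigcupr image_bigcup.
exact: outer_measure_sigma_subadditive.
Qed.

HB.instance Definition _ := isOuterMeasure.Build R S image_measure
  image_measure0 image_measure_ge0 le_image_measure
  image_measure_sigma_subadditive.

End Pullback.

(** * Averages over a grid of the torus *)

Section Grid.
Variables (R : realType) (k : nat).
Local Notation pt := 'rV[R]_k.

Definition close (t : R) (x y : pt) := forall a, `|x 0 a - y 0 a| <= t.

Definition integral_vec (z : pt) := forall a, z 0 a \is a Num.int.

Definition periodic (h : pt -> R) :=
  forall x z, integral_vec z -> h (x + z) = h x.

Definition grid_point (N : nat) (g : {ffun 'I_k -> 'I_(2 ^ N)}) : pt :=
  \row_a ((g a)%:R / 2 ^+ N).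

(** Modulo the integer lattice, adding a vector of the grid permutes the grid points: it adds a
    constant to each index modulo [2 ^ N]. *)
Lemma sum_grid_shift (N : nat) (h : pt -> R) (v : pt) :
  periodic h -> integral_vec (2 ^+ N *: v) ->
  \sum_(g : {ffun 'I_k -> 'I_(2 ^ N)}) h (grid_point g + v) =
  \sum_(g : {ffun 'I_k -> 'I_(2 ^ N)}) h (grid_point g).
Proof.
move=> hper vint.
have m_gt0 : (0 < 2 ^ N)%N by rewrite expn_gt0.
pose zf a := Num.floor (2 ^+ N * v 0 a).
have zfE a : 2 ^+ N * v 0 a = (zf a)%:~R.
  by have /floorK := vint a; rewrite mxE => <-.
pose z a := `|(zf a %% (2 ^ N)%N)%Z|%N.
pose sh (g : {ffun 'I_k -> 'I_(2 ^ N)}) : {ffun 'I_k -> 'I_(2 ^ N)} :=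
  [ffun a => Ordinal (ltn_pmod (g a + z a) m_gt0)].
have sh_inj : injective sh.
  move=> g g' /ffunP E; apply/ffunP => a; move: (E a); rewrite !ffunE => -[].
  move=> /eqP; rewrite eqn_modDr !modn_small // => /eqP gg.
  exact: val_inj.
rewrite [RHS](reindex_inj sh_inj) /=; apply: eq_bigr => g _.
(* [w] is what reduction modulo the lattice removes: the quotient of the shift by [2 ^ N] and the
   carry of the addition. *)
pose w : pt := \row_a
  ((zf a %/ (2 ^ N)%N)%Z%:~R + ((g a + z a) %/ 2 ^ N)%N%:R).
have wint : integral_vec w.
  by move=> a; rewrite mxE rpredD ?intr_int// natr_int.
rewrite -[RHS](hper _ w wint); congr h; apply/rowP => a; rewrite !mxE ffunE /=.
have h2 : (2 ^+ N : R) != 0 by rewrite expf_neq0 ?pnatr_eq0.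
have zE : (z a)%:Z = (zf a %% (2 ^ N)%N)%Z.
  by rewrite /z gez0_abs// modz_ge0// -lt0n expn_gt0.
have := divz_eq (zf a) (2 ^ N)%N; rewrite -zE.
have := zfE a; set q := (_ %/ _)%Z => va vq.
move: va; rewrite {}vq intrD intrM -!pmulrn natrX => va.
have /(congr1 (fun n => n%:R : R)) := divn_eq (g a + z a) (2 ^ N).
rewrite !natrD natrM natrX; set q2 := ((_ %/ _)%N)%:R; set r := ((_ %% _)%N)%:R.
move=> E2; apply: (mulfI h2).
have -> : (g a)%:R = q2 * 2 ^+ N + r - (z a)%:R :> R by rewrite -E2 addrK.
by rewrite !mulrDr va; field.
Qed.

End Grid.

(** * The energy of a periodic distance *)

Record periodic_distance (R : realType) (k : nat) (L : R)
    (rho : 'rV[R]_k -> 'rV[R]_k -> R) : Prop := PeriodicDistance {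
  rho_ge0 : forall x y, 0 <= rho x y ;
  rho_sym : forall x y, rho x y = rho y x ;
  rho_tri : forall y x z, rho x z <= rho x y + rho y z ;
  rho_lip : forall t x y, close t x y -> rho x y <= L * t ;
  rho_per : forall x y z, integral_vec z -> rho (x + z) y = rho x y }.

Section Energy.
Variables (R : realType) (k : nat).
Local Notation pt := 'rV[R]_k.
Variables (L : R) (rho : pt -> pt -> R).
Hypotheses (L0 : 0 <= L) (hrho : periodic_distance L rho).

(** A difference quotient of [rho] at [p] in direction [u]; halving the step can only increase it on
    average ([slope_mid]). *)
Definition slope (u p : pt) (n : nat) : R := 2 ^+ n * rho p (p + 2 ^- n *: u).

(* Nonnegative by the triangle inequality and convexity of the square; it is zero
   only when the three slopes agree. *)
Definition defect (u p : pt) (n : nat) : R :=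
  (slope u p n.+1 ^+ 2 + slope u (p + 2 ^- n.+1 *: u) n.+1 ^+ 2) / 2
  - slope u p n ^+ 2.

Lemma pow2_gt0 n : 0 < 2 ^+ n :> R. Proof. by rewrite exprn_gt0. Qed.

Lemma slope_ge0 u p n : 0 <= slope u p n.
Proof. by rewrite mulr_ge0 ?(rho_ge0 hrho)// ltW// pow2_gt0. Qed.

Lemma slope_mid u p n :
  slope u p n <= (slope u p n.+1 + slope u (p + 2 ^- n.+1 *: u) n.+1) / 2.
Proof.
rewrite /slope.
have := rho_tri hrho (p + 2 ^- n.+1 *: u) p (p + 2 ^- n *: u).
have -> : p + 2 ^- n.+1 *: u + 2 ^- n.+1 *: u = p + 2 ^- n *: u.
  rewrite -addrA -scalerDl; congr (_ + _ *: _).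
  by rewrite exprS; have /lt0r_neq0 := pow2_gt0 n; move=> ?; field.
move=> h; have -> (a b : R) : (2 ^+ n.+1 * a + 2 ^+ n.+1 * b) / 2 = 2 ^+ n * (a + b).
  by rewrite exprS; field.
by rewrite ler_wpM2l// ltW// pow2_gt0.
Qed.

Lemma defect_ge0 u p n : 0 <= defect u p n.
Proof.
rewrite /defect; have := slope_mid u p n; have := slope_ge0 u p n.
set a := slope u p n; set b := slope u p n.+1; set c := slope _ _ _ => a0 abc.
have -> : (b ^+ 2 + c ^+ 2) / 2 - a ^+ 2 =
  ((b - c) / 2) ^+ 2 + ((b + c) / 2 - a) ^+ 2 + 2 * (a * ((b + c) / 2 - a)) by field.
have h1 : 0 <= a * ((b + c) / 2 - a) by rewrite mulr_ge0// subr_ge0.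
have h2 := sqr_ge0 ((b - c) / 2); have h3 := sqr_ge0 ((b + c) / 2 - a).
by rewrite !addr_ge0 // mulr_ge0.
Qed.

Lemma defect_small (e : R) u p n : 0 <= e -> defect u p n <= e ^+ 2 ->
  `|slope u p n - slope u p n.+1| <= 2 * e.
Proof.
rewrite /defect; have := slope_mid u p n; have := slope_ge0 u p n.
set a := slope u p n; set b := slope u p n.+1; set c := slope _ _ _.
move=> a0 abc e0 he.
have h1 : 0 <= ((b + c) / 2 - a) * a by rewrite mulr_ge0// subr_ge0.
(* This square is [(c - a) ^+ 2]; together with [(a - b) ^+ 2] it is, by the parallelogram law and
   [h1], at most twice the defect. *)
have h2 : 0 <= (((b + c) / 2 - a) + (c - b) / 2) ^+ 2 by rewrite sqr_ge0.
have : (a - b) ^+ 2 <= (2 * e) ^+ 2 by nra.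
by rewrite -ler_sqrt ?exprn_ge0 ?mulr_ge0// !sqrtr_sqr (@ger0_norm _ (2 * e))// mulr_ge0.
Qed.

Lemma slope_le u p n : close 1 u 0 -> slope u p n <= L.
Proof.
move=> u1; have c : close (2 ^- n) p (p + 2 ^- n *: u).
  move=> a; have := u1 a; rewrite !mxE subr0 opprD addNKr normrN normrM.
  by rewrite ger0_norm ?invr_ge0 ?exprn_ge0// => ?; rewrite ler_piMr// invr_ge0 exprn_ge0.
have := rho_lip hrho c; rewrite /slope => h.
apply: (le_trans (ler_wpM2l (ltW (pow2_gt0 n)) h)).
by rewrite mulrC divfK// lt0r_neq0// pow2_gt0.
Qed.

Lemma closeC t (x y : pt) : close t x y -> close t y x.
Proof. by move=> h a; rewrite distrC. Qed.

Lemma close_add2 t (x y z : pt) : close t x y -> close t (x + z) (y + z).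
Proof. by move=> h a; have := h a; rewrite !mxE => ?; rewrite opprD addrACA subrr addr0. Qed.

Lemma slope_lip u p q n t : close t p q ->
  `|slope u p n - slope u q n| <= 2 * L * 2 ^+ n * t.
Proof.
move=> h.
have h1 := rho_lip hrho h.
have h2 := rho_lip hrho (close_add2 (2 ^- n *: u) h).
have t1 := rho_tri hrho q p (p + 2 ^- n *: u).
have t2 := rho_tri hrho (q + 2 ^- n *: u) q (p + 2 ^- n *: u).
have t3 := rho_tri hrho p q (q + 2 ^- n *: u).
have t4 := rho_tri hrho (p + 2 ^- n *: u) p (q + 2 ^- n *: u).
rewrite (rho_sym hrho q p) in t3.
rewrite (rho_sym hrho (q + _) (p + _)) in t2.
rewrite /slope -mulrBr normrM ger0_norm ?exprn_ge0//.
have -> : 2 * L * 2 ^+ n * t = 2 ^+ n * (2 * L * t) by ring.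
rewrite ler_wpM2l ?exprn_ge0// ler_norml; apply/andP; split; lra.
Qed.

Lemma slope_sq_lip u p q n t : close 1 u 0 -> 0 <= t -> close t p q ->
  `|slope u p n ^+ 2 - slope u q n ^+ 2| <= 4 * L ^+ 2 * 2 ^+ n * t.
Proof.
move=> u1 t0 h; have := slope_lip u n h.
have := slope_le p n u1; have := slope_le q n u1.
have := slope_ge0 u p n; have := slope_ge0 u q n.
rewrite subr_sqr normrM; set a := slope _ _ _; set b := slope _ _ _ => a0 b0 aL bL ab.
have -> : 4 * L ^+ 2 * 2 ^+ n * t = (2 * L * 2 ^+ n * t) * (2 * L) by ring.
by apply: ler_pM => //; rewrite ger0_norm ?addr_ge0//; lra.
Qed.

Lemma defect_lip u p q n t : close 1 u 0 -> 0 <= t -> close t p q ->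
  `|defect u p n - defect u q n| <= 12 * L ^+ 2 * 2 ^+ n * t.
Proof.
move=> u1 t0 h; have h1 := slope_sq_lip n u1 t0 h.
have h2 := slope_sq_lip n.+1 u1 t0 h.
have h3 := slope_sq_lip n.+1 u1 t0 (close_add2 (2 ^- n.+1 *: u) h).
move: h1 h2 h3; rewrite /defect.
have -> : 4 * L ^+ 2 * 2 ^+ n.+1 * t = 2 * (4 * L ^+ 2 * 2 ^+ n * t).
  by rewrite (exprS 2 n); ring.
have -> : 12 * L ^+ 2 * 2 ^+ n * t = 3 * (4 * L ^+ 2 * 2 ^+ n * t) by ring.
set X := 4 * _ * _ * _; set a := slope _ _ _ ^+ 2; set b := slope _ _ _ ^+ 2.
set c := slope _ _ _ ^+ 2; set d := slope _ _ _ ^+ 2.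
set e := slope _ _ _ ^+ 2; set f := slope _ _ _ ^+ 2.
rewrite !ler_norml => /andP[? ?] /andP[? ?] /andP[? ?]; apply/andP; split; lra.
Qed.

Lemma defect_le u p n : close 1 u 0 -> defect u p n <= L ^+ 2.
Proof.
move=> u1; rewrite /defect; have := slope_le p n.+1 u1.
have := slope_le (p + 2 ^- n.+1 *: u) n.+1 u1.
have := slope_ge0 u p n.+1; have := slope_ge0 u (p + 2 ^- n.+1 *: u) n.+1.
set b := slope u p n.+1; set c := slope _ _ n.+1 => c0 b0 cL bL.
have h := sqr_ge0 (slope u p n).
nra.
Qed.

Lemma rho_perr x y z : integral_vec z -> rho x (y + z) = rho x y.
Proof. by move=> hz; rewrite (rho_sym hrho) (rho_per hrho)// (rho_sym hrho). Qed.

Lemma slope_per u n : periodic (fun p => slope u p n).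
Proof.
by move=> p z hz; rewrite /slope (rho_per hrho) // addrAC (rho_perr _ _ hz).
Qed.

Lemma defect_per u n : periodic (fun p => defect u p n).
Proof.
move=> p z hz; rewrite /defect addrAC.
by rewrite !(slope_per u _ _ hz).
Qed.

(* Translation invariance turns the sum over n into a telescoping one. *)
Lemma sum_defect (M N s : nat) u : close 1 u 0 ->
  (forall n, (n < N + s)%N -> integral_vec (2 ^+ M *: (2 ^- n.+1 *: u))) ->
  \sum_(g : {ffun 'I_k -> 'I_(2 ^ M)}) \sum_(n < N)
     defect u (grid_point R g) (n + s)%N <= L ^+ 2 * #|{ffun 'I_k -> 'I_(2 ^ M)}|%:R.
Proof.
move=> u1 hu; rewrite exchange_big /=.
pose E n := \sum_(g : {ffun 'I_k -> 'I_(2 ^ M)}) slope u (grid_point R g) n ^+ 2.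
have EE (n : 'I_N) : \sum_(g : {ffun 'I_k -> 'I_(2 ^ M)}) defect u (grid_point R g) (n + s)%N
    = E (n + s).+1 - E (n + s)%N.
  rewrite /defect sumrB; congr (_ - _); rewrite -mulr_suml big_split /=.
  rewrite (@sum_grid_shift _ _ _ (fun p => slope u p (n + s).+1 ^+ 2)).
  - by rewrite -mulr2n -[X in X / _]mulr_natr mulfK// pnatr_eq0.
  - by move=> p z hz; rewrite (slope_per u _ _ hz).
  - by apply: hu; rewrite ltn_add2r.
rewrite (eq_bigr _ (fun n _ => EE n)).
rewrite -(big_mkord xpredT (fun n => E (n + s).+1 - E (n + s)%N)).
rewrite (@telescope_sumr _ 0 N (fun n => E (n + s)%N))//.
have E0 : 0 <= E (0 + s)%N by apply: sumr_ge0 => g _; rewrite sqr_ge0.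
apply: (@le_trans _ _ (E (N + s)%N)); first lra.
rewrite /E mulr_natr -sumr_const; apply: ler_sum => g _.
by rewrite lerXn2r ?nnegrE ?slope_ge0// slope_le.
Qed.

End Energy.

(** * A dyadic net of directions *)

Section Net.
Variables (R : realType) (k j : nat).
Local Notation pt := 'rV[R]_k.

(** Indices of the points of mesh [2 ^- j] in the cube [[-1, 1] ^ k], end points included; they
    serve both as directions and as offsets of base points. *)
Definition net := {ffun 'I_k -> 'I_(2 ^ j.+1).+1}.

Definition net_vec (w : net) : pt := \row_a ((w a)%:R / 2 ^+ j - 1).

Lemma net_vec_close w : close 1 (net_vec w) 0.
Proof.
move=> a; rewrite !mxE subr0 ler_norml.
have : ((w a)%:R : R) <= 2 ^+ j.+1 by rewrite -natrX ler_nat -ltnS.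
rewrite exprS => h; have h0 : 0 <= ((w a)%:R : R) by [].
have P0 := pow2_gt0 R j.
have h1 : (w a)%:R / 2 ^+ j <= 2 :> R by rewrite ler_pdivrMr.
have h2 : 0 <= (w a)%:R / 2 ^+ j :> R by rewrite divr_ge0// ltW.
by apply/andP; split; lra.
Qed.

Lemma net_dense (z : pt) : close 1 z 0 -> exists w, close (2 ^- j) (net_vec w) z.
Proof.
move=> z1; have P0 := pow2_gt0 R j.
have zlt a : (Num.truncn ((z 0%R a + 1) * 2 ^+ j) < (2 ^ j.+1).+1)%N.
  rewrite ltnS; have := z1 a; rewrite mxE subr0 ler_norml => /andP[z0 z2].
  rewrite truncn_le_nat; apply: (@le_lt_trans _ _ (2 ^+ j.+1)).
    by rewrite exprS ler_wpM2r ?(ltW P0)//; lra.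
  by rewrite -natrX ltr_nat.
exists [ffun a => Ordinal (zlt a)] => a; rewrite !mxE ffunE /=.
have := z1 a; rewrite mxE subr0 ler_norml => /andP[z0 z2].
have z3 : 0 <= (z 0 a + 1) * 2 ^+ j by rewrite mulr_ge0 ?(ltW P0)//; lra.
have /andP[] := truncn_itv z3.
set T := (Num.truncn _)%:R; rewrite -[X in _ < X%:R]addn1 natrD -/T => h1 h2.
have -> : T / 2 ^+ j - 1 - z 0 a = (T - (z 0 a + 1) * 2 ^+ j) / 2 ^+ j.
  by field; exact: lt0r_neq0.
rewrite normrM normfV (ger0_norm (ltW P0)).
by rewrite ler_piMl ?invr_ge0 ?(ltW P0)// ler_norml; apply/andP; split; lra.
Qed.

Lemma net_vec_integral (M n : nat) (w : net) : (n + j <= M)%N ->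
  integral_vec (2 ^+ M *: (2 ^- n *: net_vec w)).
Proof.
move=> njM a; rewrite !mxE.
have -> : M = (M - (n + j) + n + j)%N by lia.
have P0 := pow2_gt0 R j; have P1 := pow2_gt0 R n.
rewrite !exprD.
have -> (c : R) : c * 2 ^+ n * 2 ^+ j * ((2 ^+ n)^-1 * ((w a)%:R / 2 ^+ j - 1)) =
  c * ((w a)%:R - 2 ^+ j) by field; rewrite !lt0r_neq0.
by rewrite -!natrX rpredM ?rpredB ?natr_int.
Qed.

End Net.

Lemma sum3_const (R : realType) (T : finType) (t : nat) (c : R) :
  \sum_(u : T) \sum_(q : T) \sum_(s < t) c = c * (#|T| * #|T| * t)%:R.
Proof.
rewrite !sumr_const card_ord -!mulrnA -[LHS]mulr_natr; congr (_ * _%:R).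
by rewrite -mulnA mulnC mulnA.
Qed.

(** * Roughness over a band of scales *)

Section Roughness.
Variables (R : realType) (k : nat).
Local Notation pt := 'rV[R]_k.
Variables (L : R) (rho : pt -> pt -> R).
Hypotheses (L0 : 0 <= L) (hrho : periodic_distance L rho).
Variables (j t : nat).
Local Notation net := (net k j).
Local Notation net_vec := (@net_vec R k j).

(* Small roughness at [x] means that near [x], for each direction of the net, the
   slopes at the scales from [n] to [n + t] agree. *)
Definition roughness (n : nat) (x : pt) : R :=
  \sum_(u : net) \sum_(q : net) \sum_(s < t)
    defect rho (net_vec u) (x + 2 ^- (n + t) *: net_vec q) (n + s)%N.

Lemma roughness_ge0 n x : 0 <= roughness n x.
Proof. by do 3 (apply: sumr_ge0 => ? _); exact: defect_ge0 hrho _ _ _. Qed.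

Lemma defect_le_roughness n x u q s : (s < t)%N ->
  defect rho (net_vec u) (x + 2 ^- (n + t) *: net_vec q) (n + s)%N
    <= roughness n x.
Proof.
move=> st; have D0 := defect_ge0 hrho.
rewrite /roughness (bigD1 u)//= (bigD1 q)//= (bigD1 (Ordinal st))//=.
have aux (a b c d : R) : 0 <= b -> 0 <= c -> 0 <= d -> a <= a + b + c + d by lra.
apply: aux.
- by apply: sumr_ge0 => ? _.
- by do 2 (apply: sumr_ge0 => ? _).
- by do 3 (apply: sumr_ge0 => ? _).
Qed.

Lemma roughness_le n x :
  roughness n x <= L ^+ 2 * (#|net| * #|net| * t)%:R.
Proof.
apply: (@le_trans _ _ (\sum_(u : net) \sum_(q : net) \sum_(s < t) L ^+ 2)).
  by do 3 (apply: ler_sum => ? _); apply: (defect_le hrho); exact: net_vec_close.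
by rewrite sum3_const.
Qed.

Lemma roughness_lip n x y d : 0 <= d -> close d x y ->
  `|roughness n x - roughness n y|
    <= 12 * L ^+ 2 * 2 ^+ t * (#|net| * #|net| * t)%:R * 2 ^+ n * d.
Proof.
move=> d0 xy; rewrite /roughness -sumrB.
under eq_bigr do (rewrite -sumrB; under eq_bigr do rewrite -sumrB).
apply: (@le_trans _ _
   (\sum_(u : net) \sum_(q : net) \sum_(s < t) 12 * L ^+ 2 * 2 ^+ (n + t) * d)).
  do 3 (apply: (le_trans (ler_norm_sum _ _ _)); apply: ler_sum => ? _).
  apply: (le_trans (defect_lip hrho _ _ d0 (close_add2 _ xy))) => //.
    exact: net_vec_close.
  rewrite ler_wpM2r// ler_wpM2l ?mulr_ge0 ?exprn_ge0//.
  by rewrite ler_weXn2l ?ler1n// leq_add2l ltnW.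
rewrite sum3_const exprD le_eqVlt; apply/orP; left; apply/eqP.
by set N := _%:R; ring.
Qed.

(** Summing over the grid removes the offsets [net_vec q], and [sum_defect] applies to each triple
    [u], [q], [s]; hence a bound that does not grow with the number [N] of scales. The margin
    [t + j] in [M] makes all shifts vectors of the grid. *)
Lemma sum_roughness (M N : nat) : (N + t + j <= M)%N ->
  \sum_(g : {ffun 'I_k -> 'I_(2 ^ M)}) \sum_(n < N) roughness n (grid_point R g)
   <= L ^+ 2 * (#|net| * #|net| * t)%:R * #|{ffun 'I_k -> 'I_(2 ^ M)}|%:R.
Proof.
move=> NM; rewrite exchange_big /= /roughness.
under eq_bigr => n _.
  rewrite exchange_big /=.
  under eq_bigr => u _.
    rewrite exchange_big /=.
    under eq_bigr => q _.
      rewrite exchange_big /=.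
      under eq_bigr => s _.
        rewrite (@sum_grid_shift _ _ _
           (fun p => defect rho (net_vec u) p (n + s)%N)); first last.
        - by apply: net_vec_integral; have := ltn_ord n; lia.
        - exact: (defect_per hrho).
        over.
      over.
    over.
  over.
rewrite exchange_big /=.
under eq_bigr do (rewrite exchange_big /=; under eq_bigr do (rewrite exchange_big /=;
  under eq_bigr do rewrite exchange_big /=)).
apply: (@le_trans _ _ (\sum_(u : net) \sum_(q : net) \sum_(s < t)
   L ^+ 2 * #|{ffun 'I_k -> 'I_(2 ^ M)}|%:R)).
  do 3 (apply: ler_sum => ? _).
  apply: (sum_defect L0 hrho) => [|n nN]; first exact: net_vec_close.
  apply: net_vec_integral.
  by match goal with i : ordinal _ |- _ => have := ltn_ord i; lia end.
by rewrite sum3_const mulrAC.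
Qed.

End Roughness.

(** * Collapsing of flat cubes *)

Section Flat.
Variables (R : realType) (k : nat).
Local Notation pt := 'rV[R]_k.
Variables (L : R) (rho : pt -> pt -> R).
Hypotheses (L0 : 0 <= L) (hrho : periodic_distance L rho).
Variables (j t : nat).
Local Notation net := (net k j).
Local Notation net_vec := (@net_vec R k j).

Lemma flat_slope (e : R) n x u q s : 0 <= e -> (s <= t)%N ->
  roughness rho j t n x <= e ^+ 2 ->
  `|slope rho (net_vec u) (x + 2 ^- (n + t) *: net_vec q) n
    - slope rho (net_vec u) (x + 2 ^- (n + t) *: net_vec q) (n + s)|
    <= 2 * e * s%:R.
Proof.
set p := x + _; move=> e0 + flat; elim: s => [_|s IH st]; first by rewrite addn0 subrr normr0 mulr0.
have {}IH := IH (ltnW st).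
have := defect_small hrho e0
  (le_trans (defect_le_roughness hrho n x u q st) flat).
rewrite -/p addnS -[s.+1]addn1 natrD.
move: IH; set a := slope _ _ _ n; set b := slope _ _ _ (n + s)%N.
set c := slope _ _ _ _ => ab bc.
have := ler_normD (a - b) (b - c); rewrite addrA subrK.
lra.
Qed.

Lemma slope_dir u v p n d : close d u v ->
  `|slope rho u p n - slope rho v p n| <= L * d.
Proof.
move=> uv; have P0 := pow2_gt0 R n.
have c : close (2 ^- n * d) (p + 2 ^- n *: u) (p + 2 ^- n *: v).
  move=> a; rewrite !mxE opprD addrACA subrr add0r -mulrBr normrM.
  by rewrite ger0_norm ?invr_ge0 ?(ltW P0)// ler_wpM2l ?invr_ge0 ?(ltW P0)//; exact: uv.
have h := rho_lip hrho c.
have h1 := rho_tri hrho (p + 2 ^- n *: u) p (p + 2 ^- n *: v).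
have h2 := rho_tri hrho (p + 2 ^- n *: v) p (p + 2 ^- n *: u).
rewrite (rho_sym hrho (p + 2 ^- n *: v)) in h2.
rewrite /slope -mulrBr normrM ger0_norm ?(ltW P0)//.
have -> : L * d = 2 ^+ n * (L * (2 ^- n * d)) by field; exact: lt0r_neq0.
by rewrite ler_wpM2l ?(ltW P0)// ler_norml; apply/andP; split; lra.
Qed.

(** The first term comes from moving the direction and both base points to the net, the second from
    passing twice through [t] scales, the third from moving the base point at scale [n]. *)
Definition flatness_error (e : R) : R :=
  6 * L * 2 ^- j + 4 * t%:R * e + 4 * L * 2 ^- t.

(** Flatness carries slopes at scale [n + t] over to the coarser scale [n], where base points at
    distance of order [2 ^- (n + t)] are so close, relative to the step, that their slopes nearly
    agree. *)
Lemma flat_translation (e : R) n x p p' z : 0 <= e ->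
  roughness rho j t n x <= e ^+ 2 ->
  close 1 z 0 -> close (2 ^- (n + t)) p x -> close (2 ^- (n + t)) p' x ->
  slope rho z p (n + t) <= slope rho z p' (n + t) + flatness_error e.
Proof.
move=> e0 flat z1 px p'x.
have P0 := pow2_gt0 R (n + t); have Pt := pow2_gt0 R t; have Pn := pow2_gt0 R n.
have Pj := pow2_gt0 R j.
have [u uz] := net_dense j z1.
have approx p1 : close (2 ^- (n + t)) p1 x ->
    exists q, close (2 ^- (n + t) * 2 ^- j) (x + 2 ^- (n + t) *: net_vec q) p1.
  move=> px1.
  have [a|q hq] := @net_dense R k j (2 ^+ (n + t) *: (p1 - x)).
    rewrite !mxE subr0 normrM ger0_norm ?(ltW P0)//.
    by have := px1 a; rewrite -ler_pdivlMl// mulr1.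
  exists q => a; have := hq a; rewrite !mxE => h.
  have -> (b : R) : x 0 a + 2 ^- (n + t) * b - p1 0 a =
      2 ^- (n + t) * (b - 2 ^+ (n + t) * (p1 0 a - x 0 a)).
    by field; exact: lt0r_neq0.
  by rewrite normrM ger0_norm ?invr_ge0 ?(ltW P0)// ler_wpM2l// invr_ge0 ltW.
have [q qp] := approx _ px; have [q' qp'] := approx _ p'x.
set P := x + _ in qp; set P' := x + _ in qp'.
have cPP' : close (2 * 2 ^- (n + t)) P P'.
  move=> a; rewrite !mxE opprD addrACA subrr add0r -mulrBr normrM.
  rewrite ger0_norm ?invr_ge0 ?(ltW P0)// mulrC ler_wpM2r ?invr_ge0 ?(ltW P0)//.
  have := net_vec_close R q a; have := net_vec_close R q' a; rewrite !mxE !subr0.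
  by rewrite !ler_norml => /andP[? ?] /andP[? ?]; apply/andP; split; lra.
have h1 := slope_lip hrho z (n + t) qp.
have h2 := slope_lip hrho z (n + t) qp'.
have h3 := slope_dir P (n + t) uz; have h4 := slope_dir P' (n + t) uz.
have h5 := flat_slope u q e0 (leqnn t) flat.
have h6 := flat_slope u q' e0 (leqnn t) flat.
have h7 := slope_lip hrho (net_vec u) n cPP'.
move: h1 h2 h3 h4 h5 h6 h7; rewrite /= -/P -/P' /flatness_error.
have -> : 2 * L * 2 ^+ (n + t) * (2 ^- (n + t) * 2 ^- j) = 2 * L * 2 ^- j.
  by field; rewrite !lt0r_neq0.
have -> : 2 * L * 2 ^+ n * (2 * 2 ^- (n + t)) = 4 * L * 2 ^- t.
  by rewrite exprD; field; rewrite !lt0r_neq0.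
set a1 := slope _ _ _ _; set a2 := slope _ _ _ _; set a3 := slope _ _ _ _.
set a4 := slope _ _ _ _; set a5 := slope _ _ _ _; set a6 := slope _ _ _ _.
set a7 := slope _ _ _ _; set a8 := slope _ _ _ _.
rewrite !ler_norml => /andP[? ?] /andP[? ?] /andP[? ?] /andP[? ?] /andP[? ?].
move=> /andP[? ?] /andP[? ?]; lra.
Qed.

(** This is [flat_translation] for the displacement [y - x], rescaled to unit size, with [x] as one
    base point. *)
Lemma flat_collapse (e d : R) n x y : 0 <= e ->
  roughness rho j t n x <= e ^+ 2 ->
  close (2 ^- (n + t)) x y -> rho x y <= d * 2 ^- (n + t) ->
  forall p, close (2 ^- (n + t)) p x ->
    rho p (p + (y - x)) <= (d + flatness_error e) * 2 ^- (n + t).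
Proof.
move=> e0 flat xy rxy p px; have P0 := pow2_gt0 R (n + t).
have z1 : close 1 (2 ^+ (n + t) *: (y - x)) 0.
  move=> a; rewrite !mxE subr0 normrM ger0_norm ?(ltW P0)//.
  by have := xy a; rewrite -ler_pdivlMl// mulr1 distrC.
have xx : close (2 ^- (n + t)) x x.
  by move=> a; rewrite subrr normr0 invr_ge0 ltW.
have := flat_translation e0 flat z1 px xx.
rewrite /slope !scalerA mulVf ?lt0r_neq0// !scale1r [x + _]addrC subrK.
rewrite ler_pdivlMr// [_ * 2 ^+ _]mulrC addrC => h; apply: (le_trans h).
by rewrite lerD2r mulrC -ler_pdivlMr.
Qed.

End Flat.

Lemma outer_measure_fin_subadditive (R : realType) (T : Type) (I : finType)
    (mu : {outer_measure set T -> \bar R}) (X : set T) (F : I -> set T) :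
  (forall x, X x -> exists i, F i x) -> (mu X <= \sum_i mu (F i))%E.
Proof.
move=> XF; pose U := \big[setU/set0]_(i : I) F i.
have XU : X `<=` U.
  by move=> x /XF[i Fix]; rewrite /U (bigD1 i)//=; left.
apply: (le_trans (le_outer_measure mu _ _ XU)); rewrite /U.
elim: (index_enum I) => [|i r IH]; first by rewrite !big_nil outer_measure0.
rewrite !big_cons; apply: (le_trans (outer_measureU2 mu _ _)).
exact: leeD.
Qed.

Section Box.
Variables (R : realType) (k : nat).
Local Notation pt := 'rV[R]_k.

(** The half-open dyadic cube of side [2 ^- m] with index [c]. *)
Definition box (m : nat) (c : 'I_k -> nat) : set pt :=
  [set x | forall a, (c a)%:R <= 2 ^+ m * x 0 a < (c a).+1%:R].

Lemma box_close m c x y : box m c x -> box m c y -> close (2 ^- m) x y.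
Proof.
move=> hx hy a; have /andP[x1 x2] := hx a; have /andP[y1 y2] := hy a.
have P0 := pow2_gt0 R m; rewrite -[X in _ <= X]mulr1 ler_pdivlMl//.
rewrite -[X in X * _](ger0_norm (ltW P0)) -normrM mulrBr ler_norml.
move: x1 x2 y1 y2; rewrite -[(c a).+1]addn1 natrD => *.
by apply/andP; split; lra.
Qed.

Variables (L : R) (rho : pt -> pt -> R).
Hypotheses (L0 : 0 <= L) (hrho : periodic_distance L rho).

Lemma rho_walk (p v : pt) (d : R) (s : nat) :
  (forall r, (r < s)%N -> rho (p + r%:R *: v) (p + r%:R *: v + v) <= d) ->
  rho p (p + s%:R *: v) <= s%:R * d.
Proof.
elim: s => [_|s IH h].
  rewrite scale0r addr0 mul0r -[X in _ <= X](mulr0 L).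
  by apply: (rho_lip hrho) => a; rewrite subrr normr0.
have h1 := IH (fun r rs => h r (ltnW rs)); have h2 := h s (ltnSn s).
have := rho_tri hrho (p + s%:R *: v) p (p + s.+1%:R *: v).
have -> : p + s.+1%:R *: v = p + s%:R *: v + v.
  by rewrite -addrA -[X in _ + (_ + X)]scale1r -scalerDl natr1.
by rewrite -[s.+1]addn1 natrD; lra.
Qed.

(** A coordinate of [v] exceeds [2 ^- (m + i.+1)], so [2 ^ i.+1] steps overshoot the side of the
    box; [q] is the last point before the first exit. *)
Lemma box_exit m c i (v : pt) (d : R) (p : pt) : 0 <= d -> box m c p ->
  (forall q, box m c q -> rho q (q + v) <= d) ->
  (exists a, 2 ^- (m + i.+1) < `|v 0 a|) ->
  exists q, [/\ box m c q, ~ box m c (q + v) & rho p q <= 2 ^+ i.+1 * d].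
Proof.
move=> d0 hp hstep [a0 va0]; have P0 := pow2_gt0 R m; have Pi := pow2_gt0 R i.+1.
have out : ~ box m c (p + (2 ^ i.+1)%N%:R *: v).
  move=> /(box_close hp)/(_ a0); rewrite !mxE opprD addNKr normrN normrM.
  rewrite natrX ger0_norm ?(ltW Pi)// leNgt => /negP; apply.
  by rewrite -ltr_pdivrMl// -invfM mulrC -exprD.
pose out_at s := `[< ~ box m c (p + s%:R *: v) >].
have ex : exists s, out_at s by exists (2 ^ i.+1)%N; exact/asboolP.
have [s /asboolP so smin] := ex_minnP ex.
have s_gt0 : (0 < s)%N.
  by case: s so {smin} => // so; exfalso; apply: so; rewrite scale0r addr0.
have inb r : (r < s)%N -> box m c (p + r%:R *: v).
  move=> rs; apply: contrapT => /asboolP/smin; lia.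
exists (p + s.-1%:R *: v); split.
- by apply: inb; lia.
- rewrite -addrA -[X in _ + (_ + X)]scale1r -scalerDl.
  by rewrite natr1 prednK.
- have : rho p (p + s.-1%:R *: v) <= s.-1%:R * d.
    by apply: rho_walk => r rs; apply: hstep; apply: inb; lia.
  move=> h; apply: (le_trans h); rewrite ler_wpM2r// -natrX ler_nat.
  by have := smin _ (introT (asboolP _) out); lia.
Qed.

(** The upper regularity bound seen through [rho]. In the application [rho] is the distance divided
    by [r], so [d <= 1] stands for radii up to [r]. *)
Definition measure_diam_bound (c0 : R) (mu : set pt -> \bar R) :=
  forall (X : set pt) (d : R), 0 < d <= 1 ->
    (forall x y, X x -> X y -> rho x y < d) -> (mu X <= (c0 * d ^+ k)%:E)%E.

End Box.

Lemma ltn_sub_mul (n c P : nat) : (0 < P)%N -> (n < c.+1 * P)%N ->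
  (n - c * P < P)%N.
Proof. by rewrite mulSn; lia. Qed.

(** With [x = 2 ^- i] and [y = 2 ^+ i]: along [2 * K] faces lie [y ^+ k] pieces each, of size
    [A * (z * x)] in dimension [k.+1], which leaves one factor [x]. *)
Lemma collapsed_constant (R : realFieldType) (k : nat) (c0 A z x y K : R) :
  x * y = 1 ->
  c0 * (A * (z * x)) ^+ k.+1 * (K * 2 * y ^+ k) =
  c0 * (2 * K * A ^+ k.+1 * x) * z ^+ k.+1.
Proof.
move=> xy; have h : x ^+ k * y ^+ k = 1 by rewrite -exprMn xy expr1n.
rewrite !exprMn (exprS x).
transitivity (c0 * (2 * K * A ^+ k.+1 * x) * z ^+ k.+1 * (x ^+ k * y ^+ k)).
  by set a := x ^+ k; set b := y ^+ k; set c := z ^+ _; set d := A ^+ _; ring.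
by rewrite h mulr1.
Qed.

Section Collapsed.
Variables (R : realType) (k' : nat).
Local Notation k := k'.+1.
Local Notation pt := 'rV[R]_k.
Variables (L : R) (rho : pt -> pt -> R).
Hypotheses (L0 : 0 <= L) (hrho : periodic_distance L rho).

(* Walking in steps of [v] until leaving the box moves each of its points,
   within small distance, into a layer along the boundary, which is covered by
   few boxes of the finer scale. *)
Lemma collapsed_box (c0 : R) (mu : {outer_measure set pt -> \bar R}) m c i
    (v : pt) (eta : R) :
  measure_diam_bound rho c0 mu -> 0 <= eta ->
  (forall p, box m c p -> rho p (p + v) <= eta * 2 ^- m) ->
  close (2 ^- (m + i)) v 0 -> (exists a, 2 ^- (m + i.+1) < `|v 0 a|) ->
  2 ^+ i.+1 * eta <= 2 ^- i -> (3 + L) * 2 ^- i <= 1 ->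
  (mu (box m c) <= (c0 * (2 * k%:R * (3 + L) ^+ k * 2 ^- i) * (2 ^- m) ^+ k)%:E)%E.
Proof.
move=> hmu eta0 hstep vi va heta hLi.
have P0 := pow2_gt0 R m; have Pi := pow2_gt0 R i; have Pmi := pow2_gt0 R (m + i).
pose D := 2 ^- (m + i) : R.
have D0 : 0 < D by rewrite invr_gt0.
(* Layers of thickness [2 ^- (m + i)] along the two faces orthogonal to direction [a]; [b] is true
   for the upper one. *)
pose layer (a : 'I_k) (b : bool) (q : pt) :=
  if b then ((c a).+1 * 2 ^ i)%N%:R - 1 <= 2 ^+ (m + i) * q 0 a
  else 2 ^+ (m + i) * q 0 a < (c a * 2 ^ i)%N%:R + 1.
pose I := ('I_k * bool * {ffun 'I_k' -> 'I_(2 ^ i)})%type.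
(* Points are classified by the fine cell in which their walk ends. The layer fixes the coordinate
   [a], so only the other [k'] are recorded. *)
pose F (abw : I) : set pt := [set p | box m c p /\ exists q,
  [/\ box m c q, rho p q <= D, layer abw.1.1 abw.1.2 q &
    forall b, let a := lift abw.1.1 b in
    (c a * 2 ^ i + abw.2 b)%N%:R <= 2 ^+ (m + i) * q 0 a
       < (c a * 2 ^ i + abw.2 b).+1%:R]].
have scale (q : pt) a : 2 ^+ (m + i) * q 0 a = 2 ^+ i * (2 ^+ m * q 0 a).
  by rewrite exprD; ring.
have boxs (q : pt) a : box m c q -> (c a * 2 ^ i)%N%:R <= 2 ^+ (m + i) * q 0 a /\
    2 ^+ (m + i) * q 0 a < ((c a).+1 * 2 ^ i)%N%:R.
  move=> /(_ a)/andP[h1 h2]; rewrite !scale !natrM natrX; split.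
    by rewrite mulrC ler_wpM2l// ltW.
  by rewrite mulrC ltr_pM2r.
have cover p : box m c p -> exists abw, F abw p.
  move=> hp; have d0 : 0 <= eta * 2 ^- m by rewrite mulr_ge0// invr_ge0 ltW.
  have [q [hq hqv hpq]] := box_exit L0 hrho d0 hp hstep va.
  have [a ha] : exists a, ~ ((c a)%:R <= 2 ^+ m * (q + v) 0 a < (c a).+1%:R).
    by apply: contrapT => /forallNP h; apply: hqv => a; have /contrapT := h a.
  have va1 : `|2 ^+ (m + i) * v 0 a| <= 1.
    rewrite normrM ger0_norm ?(ltW Pmi)//.
    by have := vi a; rewrite mxE subr0 -ler_pdivlMl// mulr1.
  (* One step leaves the box in direction [a] and changes that coordinate by at most [2 ^- (m + i)],
     so [q] lies in a layer. *)
  have [b hb] : exists b, layer a b q.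
    apply: contrapT => /forallNP nolayer; apply: ha.
    move: (nolayer true) (nolayer false) => /= /negP; rewrite -ltNge => n1.
    move=> /negP; rewrite -leNgt => n2.
    move: va1; rewrite ler_norml => /andP[v1 v2].
    rewrite -(ler_pM2l Pi) -(ltr_pM2l Pi) mulrA -exprD [(i + m)%N]addnC.
    rewrite mxE mulrDr ![2 ^+ i * _%:R]mulrC -!natrX -!natrM natrX.
    by apply/andP; split; lra.
  have wlt (b' : 'I_k') : (Num.truncn (2 ^+ (m + i) * q 0%R (lift a b'))
       - c (lift a b') * 2 ^ i < 2 ^ i)%N.
    have [q1 q2] := boxs q (lift a b') hq.
    have q0 : 0 <= 2 ^+ (m + i) * q 0 (lift a b') by exact: le_trans q1.
    by move: q2; rewrite -truncn_lt_nat//; apply: ltn_sub_mul; rewrite expn_gt0.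
  exists (a, b, [ffun b' => Ordinal (wlt b')]); split => //.
  exists q; split => //.
    apply: (le_trans hpq); rewrite mulrA /D exprD invfM mulrC.
    by rewrite ler_wpM2l ?invr_ge0 ?(ltW P0).
  move=> b' /=; rewrite ffunE /=.
  have [q1 q2] := boxs q (lift a b') hq.
  have q0 : 0 <= 2 ^+ (m + i) * q 0 (lift a b') by exact: le_trans q1.
  rewrite subnKC; first exact: truncn_itv.
  by rewrite truncn_ge_nat.
(* [D] from [p] to [q], [L * D] from [q] to [q'] and [D] back; the third [D] makes the inequality
   strict. *)
have Fdiam abw p p' : F abw p -> F abw p' -> rho p p' < (3 + L) * D.
  move=> [hp [q [hq pq lq wq]]] [hp' [q' [hq' pq' lq' wq']]].
  have qq' : close D q q'.
    move=> a; rewrite -[X in _ <= X]mulr1 ler_pdivlMl//.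
    rewrite -[X in X * _](ger0_norm (ltW Pmi)) -normrM mulrBr.
    have [e1 e2] := boxs q a hq; have [e3 e4] := boxs q' a hq'.
    move: abw lq lq' wq wq' => [[a1 b1] w] /= lq lq' wq wq'.
    case: (unliftP a1 a) => [b aE|aE].
      have := wq b; have := wq' b; rewrite -aE -![(_ + _).+1%N]addn1 natrD.
      move=> /andP[? ?] /andP[? ?]; rewrite ler_norml; apply/andP; split; lra.
    move: e1 e2 e3 e4; rewrite aE ler_norml.
    by case: b1 lq lq' => /= ? ? ? ? ? ?; apply/andP; split; lra.
  have h1 := rho_lip hrho qq'; have h2 := rho_tri hrho q p p'.
  have h3 := rho_tri hrho q' q p'; rewrite (rho_sym hrho q' p') in h3.
  by lra.
apply: (le_trans (outer_measure_fin_subadditive mu cover)).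
have bound abw : (mu (F abw) <= (c0 * ((3 + L) * D) ^+ k)%:E)%E.
  apply: hmu; last by move=> p p'; exact: Fdiam.
  apply/andP; split; first by rewrite mulr_gt0 ?D0 // ltr_wpDr.
  apply: le_trans hLi; rewrite ler_wpM2l ?addr_ge0//.
  by rewrite /D exprD invfM ler_piMl ?invr_ge0 ?(ltW Pi)// invf_le1// exprn_ege1// ler1n.
apply: (@le_trans _ _ (\sum_(abw : I) (c0 * ((3 + L) * D) ^+ k)%:E)%E).
  by apply: lee_sum => abw _.
rewrite sumEFin lee_fin sumr_const !card_prod !card_ord card_bool card_ffun !card_ord.
rewrite -[X in X <= _]mulr_natr !natrM !natrX /D exprD invfM.
rewrite (@collapsed_constant _ _ _ _ _ (2 ^- i))//.
by rewrite mulVf// lt0r_neq0.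
Qed.

End Collapsed.

(** * Stopping cubes *)

Section Cells.
Variables (R : realType) (k : nat).
Local Notation pt := 'rV[R]_k.

Definition unit_cube : set pt := [set x | forall a, 0 <= x 0 a < 1].

Definition cell (m : nat) (x : pt) : 'I_k -> nat :=
  fun a => Num.truncn (2 ^+ m * x 0 a).

Lemma box_cell m x : unit_cube x -> box m (cell m x) x.
Proof.
move=> x1 a; apply: truncn_itv; rewrite mulr_ge0 ?(ltW (pow2_gt0 _ _))//.
by have /andP[] := x1 a.
Qed.

Lemma cell_lt m x a : unit_cube x -> (cell m x a < 2 ^ m)%N.
Proof.
move=> x1; have /andP[x0 x2] := x1 a; have P0 := pow2_gt0 R m.
by rewrite /cell truncn_lt_nat ?mulr_ge0 ?(ltW P0)// natrX gtr_pMr.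
Qed.

Lemma cell_box m m' c x : (m' <= m)%N -> box m c x ->
  cell m' x = fun a => (c a %/ 2 ^ (m - m'))%N.
Proof.
move=> m'm hx; apply/funext => a; have /andP[h1 h2] := hx a.
apply: truncn_def; have P0 := pow2_gt0 R (m - m').
have e : 2 ^+ m * x 0 a = 2 ^+ (m - m') * (2 ^+ m' * x 0 a).
  by rewrite mulrA -exprD subnK.
rewrite e in h1 h2.
have p0 : (0 < 2 ^ (m - m'))%N by rewrite expn_gt0.
apply/andP; split.
  rewrite -(ler_pM2l P0); apply: le_trans h1.
  by rewrite mulrC -natrX -natrM ler_nat leq_trunc_div.
rewrite -(ltr_pM2l P0); apply: (lt_le_trans h2).
by rewrite mulrC -natrX -natrM ler_nat ltn_ceil.
Qed.

Local Notation C m := {ffun 'I_k -> 'I_(2 ^ m)}.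

Lemma grid_point_box M (g : C M) : box M (fun a => g a) (grid_point R g).
Proof.
move=> a; rewrite mxE mulrC divfK ?(lt0r_neq0 (pow2_gt0 _ _))//.
by rewrite lexx ltr_nat ltnSn.
Qed.

Lemma cell_grid_point M m (g : C M) : (m <= M)%N ->
  cell m (grid_point R g) = fun a => (g a %/ 2 ^ (M - m))%N.
Proof. by move=> mM; rewrite (cell_box mM (@grid_point_box M g)). Qed.

Lemma card_subgrid M m (c : C m) : (m <= M)%N ->
  ((2 ^ (M - m)) ^ k <=
     #|[pred g : C M | [forall a, g a %/ 2 ^ (M - m) == c a]]|)%N.
Proof.
move=> mM; set e := (M - m)%N; have p0 : (0 < 2 ^ e)%N by rewrite expn_gt0.
have lt a (w : C e) : (c a * 2 ^ e + w a < 2 ^ M)%N.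
  rewrite -(subnK mM) -/e expnD [X in (_ < X)%N]mulnC.
  apply: (@leq_trans ((c a).+1 * 2 ^ e)).
    by rewrite mulSn addnC -addSn leq_add2r.
  by rewrite leq_mul2r ltn_ord orbT.
pose f (w : C e) : C M := [ffun a => Ordinal (lt a w)].
have finj : injective f.
  move=> w w' /ffunP h; apply/ffunP => a; have := h a; rewrite !ffunE => -[].
  by move=> /eqP; rewrite eqn_add2l => /eqP ?; apply: val_inj.
have -> : ((2 ^ e) ^ k)%N = #|[set f w | w in [set: C e]%SET]%SET|.
  by rewrite card_imset// cardsT card_ffun !card_ord.
apply: subset_leq_card; apply/fintype.subsetP => g /imsetP[w _ ->]; rewrite inE.
by apply/forallP => a; rewrite ffunE /= divnMDl// divn_small ?addn0.
Qed.

Variables (P : nat -> ('I_k -> nat) -> Prop).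

(** The stopping cubes. Dividing the index by [2 ^ (m - m')] gives the ancestor at level [m']. *)
Definition first_hit (m : nat) (c : C m) : Prop :=
  P m (fun a => c a) /\ forall m', (m' < m)%N ->
    ~ P m' (fun a => (c a %/ 2 ^ (m - m'))%N).

Definition below m (c : C m) M (g : C M) := [forall a, (g a %/ 2 ^ (M - m))%N == c a].

Lemma below_cell m (c : C m) M (g : C M) : (m <= M)%N -> below c g ->
  cell m (grid_point R g) = fun a => c a.
Proof.
move=> mM /forallP gc; rewrite cell_grid_point//; apply/funext => a.
exact/eqP.
Qed.

Lemma first_hit_below m (c : C m) M (g : C M) : (m <= M)%N -> below c g ->
  first_hit c -> P m (cell m (grid_point R g)) /\
    forall m', (m' < m)%N -> ~ P m' (cell m' (grid_point R g)).
Proof.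
move=> mM gc [Pm nP]; split; first by rewrite (below_cell mM gc).
move=> m' m'm; have := nP m' m'm; congr (~ P _ _); apply/funext => a.
rewrite cell_grid_point ?(leq_trans (ltnW m'm))//.
have -> : (M - m' = (M - m) + (m - m'))%N by lia.
by rewrite expnD divnMA; move/forallP: gc => /(_ a)/eqP ->.
Qed.

(** A stopping cube of level [m] contains at least [(2 ^ (M' - m)) ^ k] grid points, all of them
    hit, and a grid point lies in at most one stopping cube. *)
Lemma first_hit_card (M M' : nat) : (M <= M')%N ->
  (\sum_(m < M) #|[pred c : C m | `[< first_hit c >]]| * (2 ^ (M' - m)) ^ k <=
  #|[pred g : C M' | `[< exists2 m, (m < M)%N & P m (cell m (grid_point R g)) >]]|)%N.
Proof.
move=> MM'; have leM (m : 'I_M) : (m <= M')%N by rewrite (leq_trans (ltnW (ltn_ord m))).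
apply: (@leq_trans (\sum_(m < M) \sum_(c : C m | `[< first_hit c >])
    \sum_(g : C M') below c g)).
  apply: leq_sum => m _; rewrite -sum_nat_const; apply: leq_sum => c _.
  by apply: (leq_trans (card_subgrid c (leM m))); rewrite -sum1_card big_mkcond.
under eq_bigr do rewrite exchange_big /=.
rewrite exchange_big /= -sum1_card [leqRHS]big_mkcond /=; apply: leq_sum => g _.
have [[m0 [c0 [h0 b0]]]|no] := pselect (exists (m : 'I_M) (c : C m),
   first_hit c /\ below c g); last first.
  rewrite big1// => m _; rewrite big1// => c /asboolP hc.
  by apply/eqP; rewrite eqb0; apply/negP => bc; apply: no; exists m, c.
have [P0 nP0] := first_hit_below (leM m0) b0 h0.
have -> : (g \in [pred g : C M' |
    `[< exists2 m, (m < M)%N & P m (cell m (grid_point R g)) >]]).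
  by rewrite inE; exists m0.
rewrite (bigD1 m0)//= (bigD1 c0)/=; last exact/asboolP.
rewrite b0 !big1 ?addn0// => [m m0m|c /andP[_ cc0]].
  rewrite big1// => c /asboolP hc; apply/eqP; rewrite eqb0; apply/negP => bc.
  have [P1 nP1] := first_hit_below (leM m) bc hc.
  case: (ltngtP m m0) => [mm0|m0m'|mm0]; first exact: (nP0 m).
    exact: (nP1 m0).
  by move/eqP: m0m; apply; exact: val_inj.
apply/eqP; rewrite eqb0; apply: contra cc0 => bc; apply/eqP/ffunP => a.
apply: val_inj => /=; move/forallP: bc => /(_ a)/eqP <-.
by move/forallP: b0 => /(_ a)/eqP <-.
Qed.

End Cells.

Section Stopping.
Variables (R : realType) (k : nat).
Local Notation pt := 'rV[R]_k.
Local Notation C m := {ffun 'I_k -> 'I_(2 ^ m)}.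
Variables (mu : {outer_measure set pt -> \bar R}) (P : nat -> ('I_k -> nat) -> Prop).

(* The hit set is a disjoint union of the boxes at which [P] first holds. *)
Lemma stopping_boxes (kappa theta : R) : 0 <= kappa ->
  (forall m c, P m c -> mu (box m c) <= (kappa * (2 ^- m) ^+ k)%:E)%E ->
  (forall M, exists2 M', (M <= M')%N &
    #|[pred g : C M' | `[< exists2 m, (m < M)%N & P m (cell m (grid_point R g)) >]]|%:R
      <= theta * #|C M'|%:R :> R) ->
  (mu [set x | unit_cube x /\ exists m, P m (cell m x)] <= (kappa * theta)%:E)%E.
Proof.
move=> kappa0 muP hP.
pose S m (c : C m) := `[< first_hit P c >].
pose F m : set pt := [set x | exists2 c : C m, S m c & box m (fun a => c a) x].
have cover : [set x | unit_cube x /\ exists m, P m (cell m x)] `<=` \bigcup_m F m.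
  move=> x [x1 Px].
  have ex : exists m, `[< P m (cell m x) >] by have [m ?] := Px; exists m; exact/asboolP.
  have [m /asboolP Pm mmin] := ex_minnP ex.
  exists m => //; exists [ffun a => Ordinal (cell_lt m a x1)].
    have cE : (fun a => [ffun a => Ordinal (cell_lt m a x1)] a : nat) = cell m x.
      by apply/funext => a; rewrite ffunE.
    apply/asboolP; split; first by rewrite cE.
    move=> m' m'm; have -> : (fun a => ([ffun a => Ordinal (cell_lt m a x1)] a
        %/ 2 ^ (m - m'))%N) = cell m' x.
      by rewrite (cell_box (ltnW m'm) (box_cell m x1)); apply/funext => a; rewrite ffunE.
    by move=> /asboolP/mmin; lia.
  by move=> a; rewrite ffunE; exact: box_cell.
apply: (le_trans (le_outer_measure mu _ _ cover)).
apply: (le_trans (outer_measure_sigma_subadditive mu F)).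
pose N m := #|[pred c : C m | S m c]|.
have muF m : (mu (F m) <= (kappa * (2 ^- m) ^+ k * (N m)%:R)%:E)%E.
  pose G (c : C m) : set pt := if S m c then box m (fun a => c a) else set0.
  apply: (@le_trans _ _ (\sum_(c : C m) mu (G c))%E).
    apply: outer_measure_fin_subadditive => x [c Sc xc].
    by exists c; rewrite /G Sc.
  apply: (@le_trans _ _ (\sum_(c : C m | S m c) (kappa * (2 ^- m) ^+ k)%:E)%E).
    rewrite [leRHS]big_mkcond /=; apply: lee_sum => c _; rewrite /G.
    case: ifPn => [/asboolP[Pc _]|_]; last by rewrite outer_measure0.
    exact: muP.
  by rewrite sumEFin lee_fin sumr_const /N mulr_natr.
apply: lime_le; first by apply: is_cvg_nneseries => n _ _; exact: outer_measure_ge0.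
apply: nearW => M.
apply: (@le_trans _ _ (\sum_(0 <= m < M) (kappa * (2 ^- m) ^+ k * (N m)%:R)%:E)%E).
  by apply: lee_sum => m _; exact: muF.
rewrite sumEFin lee_fin big_mkord.
under eq_bigr do rewrite -mulrA.
rewrite -mulr_sumr ler_wpM2l//.
(* Counting grid points at level [M'] bounds the total volume of the stopping cubes of level below
   [M] by [theta], uniformly in [M]. *)
have [M' MM' hM'] := hP M.
have := first_hit_card R P MM'; rewrite -(ler_nat R) => h.
have {hM'}h := le_trans h hM'.
have Q0 : 0 < (2 ^+ M') ^+ k :> R by rewrite exprn_gt0// pow2_gt0.
rewrite card_ffun !card_ord !natrX in h.
rewrite -(ler_pM2r Q0); apply: le_trans h.
rewrite natr_sum mulr_suml; apply: ler_sum => m _.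
rewrite natrM !natrX -/(N m).
have mM' : (m <= M')%N by rewrite (leq_trans (ltnW (ltn_ord m))).
rewrite [_ * (N m)%:R]mulrC -mulrA ler_wpM2l// -exprMn.
rewrite -{1}(subnK mM') exprD mulrCA mulVf ?mulr1//.
Qed.
End Stopping.

(** * Separating codes *)

Lemma exists_pow2 (R : realType) (A B : R) : 0 <= A -> 0 < B ->
  exists n : nat, A * 2 ^- n <= B.
Proof.
move=> A0 B0; exists (Num.truncn (A / B)).+1.
have P0 := pow2_gt0 R (Num.truncn (A / B)).+1.
rewrite ler_pdivrMr// mulrC -ler_pdivrMr//.
have /andP[_ /ltW h] := truncn_itv (divr_ge0 A0 (ltW B0)); apply: (le_trans h).
by rewrite -natrX ler_nat ltnW// ltn_expl.
Qed.

Lemma modn4_eq (A B : nat) : (A %% 4 = B %% 4)%N ->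
  [\/ A = B, (A + 4 <= B)%N | (B + 4 <= A)%N].
Proof.
move=> h; have [?|?|?] := ltngtP A B.
- by apply: Or32; lia.
- by apply: Or33; lia.
- exact: Or31.
Qed.

Section Code.
Variables (R : realType) (k : nat).
Local Notation pt := 'rV[R]_k.

Lemma exists_max_coordinate (x y : pt) : x <> y ->
  exists2 a, 0 < `|x 0 a - y 0 a| & close `|x 0 a - y 0 a| x y.
Proof.
move=> xy; have [a0 ha0] : exists a, x 0 a != y 0 a.
  apply: contrapT => /forallNP h; apply: xy; apply/rowP => a.
  by have /negP/negPn/eqP := h a.
case: (@Order.TotalTheory.arg_maxP _ _ _ a0 xpredT (fun a => `|x 0 a - y 0 a|) isT).
move=> a _ amax; exists a; last by move=> b; exact: amax.
by apply: lt_le_trans (amax a0 isT); rewrite normr_gt0 subr_eq0.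
Qed.

Lemma exists_dyadic_scale (l : nat) (d : R) : 0 < d -> d <= 2 ^- l ->
  exists2 n, 2 ^- (n + l).+1 < d & d <= 2 ^- (n + l).
Proof.
move=> d0 dl; have [n0 hn0] : exists n, 2 ^- (n + l).+1 < d.
  have [n] := @exists_pow2 R 1 d ler01 d0; rewrite mul1r => h; exists n.
  apply: lt_le_trans h; rewrite ltf_pV2 ?posrE ?pow2_gt0//.
  by rewrite ltr_eXn2l ?ltr1n//; lia.
have ex : exists n, (fun n => 2 ^- (n + l).+1 < d) n by exists n0.
have [n hn nmin] := ex_minnP ex; exists n => //.
case: n hn nmin => [//|n _ nmin]; rewrite leNgt; apply/negP => h.
by have := nmin n h; rewrite ltnn.
Qed.

Definition layer_sum (S : nat -> pt -> R) (b r q : nat) (x : pt) : R :=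
  \sum_(q' < q) S (r + q' * b)%N x.

Section LayerSum.
Variables (S : nat -> pt -> R) (b : nat).
Hypotheses (S0 : forall n x, 0 <= S n x) (b0 : (0 < b)%N).

Lemma layer_sumS r q x :
  layer_sum S b r q.+1 x = layer_sum S b r q x + S (r + q * b)%N x.
Proof. by rewrite /layer_sum big_ord_recr. Qed.

Lemma le_layer_sum r q q' x : (q <= q')%N ->
  layer_sum S b r q x <= layer_sum S b r q' x.
Proof.
move=> /subnK <-; elim: (q' - q)%N => [//|n IH].
by rewrite addSn layer_sumS (le_trans IH)// lerDl.
Qed.

Lemma layer_sum_le r q x :
  layer_sum S b r q x <= \sum_(n < r + q * b) S n x.
Proof.
have mono n d : \sum_(m < n) S m x <= \sum_(m < n + d) S m x.
  by rewrite big_split_ord /= lerDl sumr_ge0.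
elim: q => [|q IH]; first by rewrite /layer_sum big_ord0 sumr_ge0.
rewrite layer_sumS; have -> : (r + q.+1 * b = (r + q * b).+1 + b.-1)%N by lia.
by apply: le_trans (mono _ _); rewrite big_ord_recr lerD2r.
Qed.

(** The Lipschitz constants of successive terms grow by the factor [2 ^+ b], so the terms before
    level [r + q * b] add up to a small fraction of the constant of that level. *)
Lemma layer_sum_lip (Lam : R) r q x y : 0 <= Lam ->
  (forall n d, 0 <= d -> close d x y -> `|S n x - S n y| <= Lam * 2 ^+ n * d) ->
  forall d, 0 <= d -> close d x y ->
  `|layer_sum S b r q x - layer_sum S b r q y|
     <= Lam * 2 ^+ (r + q * b) * d * (2 * 2 ^- b).
Proof.
move=> Lam0 hlip d d0 xy; rewrite /layer_sum -sumrB.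
have Pb := pow2_gt0 R b.
elim: q => [|q IH].
  by rewrite big_ord0 normr0 !mulr_ge0 ?invr_ge0 ?exprn_ge0.
rewrite big_ord_recr /=; apply: (le_trans (ler_normD _ _)).
have h := hlip (r + q * b)%N d d0 xy; apply: (le_trans (lerD IH h)).
rewrite mulSn addnCA (exprD _ b); set X := 2 ^+ (r + q * b).
have -> : Lam * (2 ^+ b * X) * d * (2 * 2 ^- b) = Lam * X * d * 2.
  by field; exact: lt0r_neq0.
have -> : Lam * X * d * (2 * 2 ^- b) + Lam * X * d = Lam * X * d * (2 * 2 ^- b + 1).
  by ring.
rewrite ler_wpM2l ?mulr_ge0 ?exprn_ge0//.
suff : 2 * 2 ^- b <= 1 :> R by lra.
by rewrite ler_pdivrMr// mul1r -[X in X <= _]expr1 ler_weXn2l ?ler1n.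
Qed.

(** The step at which the class sum passes [s * h], and [0] if it never does; by monotonicity there
    is at most one. *)
Definition slot_index (h : R) (r s : nat) (x : pt) : nat :=
  xget 0%N [set q | layer_sum S b r q x <= s%:R * h < layer_sum S b r q.+1 x].

Lemma slot_indexE h r s q x :
  layer_sum S b r q x <= s%:R * h < layer_sum S b r q.+1 x ->
  slot_index h r s x = q.
Proof.
move=> hq; rewrite /slot_index; case: xgetP => [q' _ /= hq'|/(_ q)//].
move: hq hq' => /andP[h1 h2] /andP[h3 h4].
case: (ltngtP q' q) => // qq'.
  by have := le_lt_trans (le_trans (le_layer_sum r x qq') h1) h4; rewrite ltxx.
by have := le_lt_trans (le_trans (le_layer_sum r x qq') h3) h2; rewrite ltxx.
Qed.

End LayerSum.

(* The word of [x] lists, for each residue class of levels modulo [b] and each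
   multiple [s * h] of a small threshold [h], the residue modulo 4 of the cell of
   [x] at the level where the sum of [S] along the class passes [s * h]. Two
   points at distance about [2 ^- n] pass a common multiple at the same level
   [n] when [S n] is large at both, because their sums before [n] differ by
   little, and their cells at that level are distinct but nearby. *)
Lemma separating_code (Lam eps N0 : R) (l : nat) : 0 <= Lam -> 0 < eps ->
  exists T : finType, forall S : nat -> pt -> R,
  (forall n x, 0 <= S n x) ->
  (forall n x y d, 0 <= d -> close d x y -> `|S n x - S n y| <= Lam * 2 ^+ n * d) ->
  exists code : pt -> T, forall x y, unit_cube x -> unit_cube y ->
    (forall m, \sum_(n < m) S n x <= N0) -> (forall m, \sum_(n < m) S n y <= N0) ->
    code x = code y -> x <> y ->
    exists n, [/\ close (2 ^- (n + l)) x y,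
      exists a, 2 ^- (n + l).+1 < `|x 0 a - y 0 a| & S n x < eps \/ S n y < eps].
Proof.
move=> Lam0 eps0; pose h := eps / 2.
have h0 : 0 < h by rewrite divr_gt0.
(* The gap [b] between levels lets the earlier part of a class sum vary by at most [eps / 4] between
   the points compared; [K] bounds the number of multiples of [h] up to [N0]. *)
have [b' hb'] := @exists_pow2 R (2 * Lam) (eps / 4) (mulr_ge0 (ler0n _ 2) Lam0)
  (divr_gt0 eps0 (ltr0n R 4)).
pose b := b'.+1; pose K := (Num.truncn (`|N0| / h)).+1.
(* Besides the word, the code stores the cell at level [l], which brings points with equal codes
   within [2 ^- l]. *)
exists ({ffun 'I_k -> 'I_(2 ^ l).+1} *
  {ffun 'I_b * 'I_K -> {ffun 'I_k -> 'I_4}})%type => S S0 Slip.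
exists (fun x : pt => ([ffun a => inord (cell l x a)],
  [ffun rs : 'I_b * 'I_K => [ffun a => inord (cell
      (rs.1 + slot_index S b h rs.1 rs.2 x * b + l).+1 x a %% 4)%N]])).
move=> x y x1 y1 Nx Ny [] /ffunP cl /ffunP cw xy.
have celll : cell l x = cell l y.
  apply/funext => a; have := cl a; rewrite !ffunE => /(congr1 val) /=.
  by rewrite !inordK// ltnS ltnW// cell_lt.
have [a0 d0 xymax] := exists_max_coordinate xy.
set d := `|x 0 a0 - y 0 a0| in d0 xymax.
have dl : d <= 2 ^- l.
  by apply: (@box_close _ _ l (cell l x)); [|rewrite celll]; exact: box_cell.
have [n nd dn] := exists_dyadic_scale d0 dl.
have xyn : close (2 ^- (n + l)) x y by move=> a; exact: le_trans (xymax a) dn.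
exists n; split => //; first by exists a0.
apply: contrapT => /not_orP[/negP]; rewrite -leNgt => Sx /negP; rewrite -leNgt => Sy.
pose r := (n %% b)%N; pose q := (n %/ b)%N.
have nE : (r + q * b = n)%N by rewrite addnC -divn_eq.
have rb : (r < b)%N by rewrite ltn_mod.
have Lxy : `|layer_sum S b r q x - layer_sum S b r q y| <= eps / 4.
  have dn0 : 0 <= 2 ^- (n + l) :> R by rewrite invr_ge0 ltW// pow2_gt0.
  apply: (le_trans (@layer_sum_lip S b isT Lam r q x y Lam0 _ _ dn0 xyn)).
    by move=> n' d' d'0 ?; exact: Slip.
  rewrite nE; apply: le_trans hb'.
  have Pn := pow2_gt0 R n; have Pl := pow2_gt0 R l; have Pb' := pow2_gt0 R b'.
  have -> : Lam * 2 ^+ n * 2 ^- (n + l) * (2 * 2 ^- b) =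
      (2 * Lam * 2 ^- b') * (2 ^- l / 2).
    by rewrite exprD /b exprS; field; rewrite !lt0r_neq0.
  rewrite ler_piMr ?mulr_ge0 ?invr_ge0 ?(ltW Pb')//.
  rewrite ler_pdivrMr// mul1r (@le_trans _ _ 1) ?ler1n//.
  by rewrite invf_le1// exprn_ege1// ler1n.
(* [s * h] is the first multiple above both sums. It exceeds each by at most [eps / 4 + h], less
   than [eps], so both pass it at level [n]. *)
pose M := Num.max (layer_sum S b r q x) (layer_sum S b r q y).
have lx0 z : 0 <= layer_sum S b r q z by rewrite sumr_ge0.
have M0 : 0 <= M by rewrite /M le_max lx0.
pose s := (Num.truncn (M / h)).+1.
have /andP[s1 s2] := truncn_itv (divr_ge0 M0 (ltW h0)).
have sM : M < s%:R * h by rewrite -ltr_pdivrMr.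
have sM2 : s%:R * h <= M + h.
  by rewrite /s -natr1 mulrDl mul1r lerD2r -ler_pdivlMr.
have [xM yM] : layer_sum S b r q x <= M /\ layer_sum S b r q y <= M.
  by rewrite /M !le_max !lexx orbT.
have MM : M <= layer_sum S b r q x + eps / 4 /\ M <= layer_sum S b r q y + eps / 4.
  move: Lxy; rewrite ler_norml => /andP[? ?].
  by rewrite /M !ge_max; split; apply/andP; split; lra.
have slot z : layer_sum S b r q z <= M -> M <= layer_sum S b r q z + eps / 4 ->
    eps <= S n z -> layer_sum S b r q z <= s%:R * h < layer_sum S b r q.+1 z.
  move=> z1 z2 z3; rewrite layer_sumS nE; apply/andP; split; first lra.
  by move: sM2; rewrite /h; lra.
have slx := slot x xM MM.1 Sx; have sly := slot y yM MM.2 Sy.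
have sK : (s < K)%N.
  rewrite /K ltnS; apply: (@leq_trans (Num.truncn (s%:R : R))); first by rewrite natrK.
  apply: le_truncn; rewrite ler_pdivlMr//.
  move/andP: slx => [_ /ltW slx]; apply: (le_trans slx).
  by rewrite (le_trans (layer_sum_le S0 (ltn0Sn b') _ _ _))// (le_trans (Nx _))// ler_norm.
have := cw (Ordinal rb, Ordinal sK); rewrite !ffunE /= => /ffunP /(_ a0).
rewrite !ffunE (slot_indexE S0 slx) (slot_indexE S0 sly) nE => /(congr1 val).
rewrite /= !inordK ?ltn_mod// => /modn4_eq c4.
have /andP[x3 x4] := box_cell (n + l).+1 x1 a0.
have /andP[y3 y4] := box_cell (n + l).+1 y1 a0.
have P0 := pow2_gt0 R (n + l).+1.
(* In units of the cells of level [(n + l).+1] the coordinates differ by more than 1 and at most 2,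
   so the cells are distinct but less than 4 apart, against the equal residues. *)
have D1 : 1 < `|2 ^+ (n + l).+1 * x 0 a0 - 2 ^+ (n + l).+1 * y 0 a0|.
  by rewrite -mulrBr normrM (ger0_norm (ltW P0)) -/d -ltr_pdivrMl// mulr1.
have D2 : `|2 ^+ (n + l).+1 * x 0 a0 - 2 ^+ (n + l).+1 * y 0 a0| <= 2.
  rewrite -mulrBr normrM (ger0_norm (ltW P0)) -/d exprS -mulrA ger_pMr//.
  by rewrite mulrC -ler_pdivlMr ?pow2_gt0// mul1r.
move: x3 x4 y3 y4 D1 D2 c4; rewrite -!natr1.
set X := _ * x 0 a0; set Y := _ * y 0 a0; set A := cell _ x a0; set B := cell _ y a0.
move=> x3 x4 y3 y4 D1; rewrite ler_norml => /andP[D2 D3].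
case=> [AB|AB|AB].
- move: D1; apply/negP; rewrite -leNgt ler_norml AB in x3 x4 *.
  by apply/andP; split; lra.
- have : (A + 4)%:R <= B%:R :> R by rewrite ler_nat.
  by rewrite natrD; lra.
- have : (B + 4)%:R <= A%:R :> R by rewrite ler_nat.
  by rewrite natrD; lra.
Qed.

End Code.

(** * Decomposition into biLipschitz pieces *)

Lemma grid_point_unit (R : realType) (k N : nat) (g : {ffun 'I_k -> 'I_(2 ^ N)}) :
  unit_cube (grid_point R g).
Proof.
move=> a; have P0 := pow2_gt0 R N; rewrite mxE divr_ge0 ?(ltW P0)//=.
by rewrite ltr_pdivrMr// mul1r -natrX ltr_nat.
Qed.

Section Core.
Variables (R : realType) (k' : nat).
Local Notation k := k'.+1.
Local Notation pt := 'rV[R]_k.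

(** Bounds the roughness at each scale and also, on average over a grid, its sum over all scales. *)
Definition roughness_const (L : R) (j t : nat) : R :=
  L ^+ 2 * (#|net k j| * #|net k j| * t)%:R.

(** Markov's inequality on the grid, passed to [mu] by [stopping_boxes]; Lipschitz bounds carry half
    of the threshold from [y] to the grid points of its box. *)
Lemma rough_set (L c0 N0 : R) (j t i : nat) (rho : pt -> pt -> R)
    (mu : {outer_measure set pt -> \bar R}) :
  0 <= L -> periodic_distance L rho -> 0 <= c0 -> measure_diam_bound rho c0 mu ->
  0 < N0 -> (L + 1) * 2 ^- i <= 1 -> roughness_const L j t * i%:R <= N0 ->
  2 * (12 * 2 ^+ t * roughness_const L j t) <= N0 ->
  (mu [set x | unit_cube x /\ exists m, exists2 y, box m (cell m x) y &
        (N0 < \sum_(n < m) roughness rho j t n y)%R]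
   <= (c0 * (L + 1) ^+ k * (2 * roughness_const L j t / N0))%:E)%E.
Proof.
move=> L0 hrho c00 hmu N00 Li sN LN; set sg := roughness_const L j t in sN LN *.
have Pi := pow2_gt0 R i; have Pt := pow2_gt0 R t.
have sg0 : 0 <= sg by rewrite mulr_ge0 ?exprn_ge0.
have S0 := roughness_ge0 hrho j t.
apply: (@stopping_boxes R k mu
  (fun m c => exists2 y, box m c y & N0 < \sum_(n < m) roughness rho j t n y)).
- by rewrite mulr_ge0 ?exprn_ge0 ?addr_ge0.
- move=> m c [y cy Ny]; rewrite -mulrA -exprMn.
  have Pm := pow2_gt0 R m.
  apply: hmu => [|p p' cp cp']; last first.
    apply: (le_lt_trans (rho_lip hrho (box_close cp cp'))).
    by rewrite ltr_pM2r ?invr_gt0// ltrDl.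
  rewrite mulr_gt0 ?invr_gt0//=; last by rewrite ltr_wpDl.
  apply: le_trans Li; rewrite ler_wpM2l ?addr_ge0// lef_pV2 ?posrE//.
  (* Below level [i] the sum has too few terms to exceed [N0], so the boxes hit are small enough for
     [hmu]. *)
  rewrite ler_weXn2l ?ler1n// leqNgt; apply/negP => mi.
  move: Ny; apply/negP; rewrite -leNgt; apply: le_trans sN.
  apply: (@le_trans _ _ (\sum_(n < m) sg)).
    by apply: ler_sum => n _; exact: roughness_le.
  by rewrite sumr_const card_ord -[X in X <= _]mulr_natr ler_wpM2l// ler_nat ltnW.
- move=> M; exists (M + t + j)%N; first by rewrite -addnA leq_addr.
  set H := [pred g | _].
  have hit g : g \in H -> N0 / 2 <= \sum_(n < M) roughness rho j t n (grid_point R g).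
    rewrite inE => -[m mM [y]].
    set g0 := grid_point R g => gy Ny.
    have gb : box m (cell m g0) g0 := box_cell m (grid_point_unit R g).
    have gc := box_close gb gy; have Pm := pow2_gt0 R m.
    have step n : roughness rho j t n y <= roughness rho j t n g0
        + 12 * 2 ^+ t * sg * 2 ^- m * 2 ^+ n.
      have inv0 : 0 <= 2 ^- m :> R by rewrite invr_ge0 ltW.
      have := roughness_lip L0 hrho j t n inv0 gc.
      have -> : 12 * L ^+ 2 * 2 ^+ t * (#|net k j| * #|net k j| * t)%:R * 2 ^+ n * 2 ^- m
         = 12 * 2 ^+ t * sg * 2 ^- m * 2 ^+ n :> R.
        by rewrite /sg /roughness_const; set N := _%:R; ring.
      by rewrite ler_norml => /andP[h1 h2]; lra.
    (* The Lipschitz constants at scales before [m] add up to order [2 ^+ m], which the side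
       [2 ^- m] of the box cancels; the loss is at most [N0 / 2]. *)
    have geom : \sum_(n < m) 2 ^+ n <= 2 ^+ m :> R.
      elim: (m) => [|m1 IH]; first by rewrite big_ord0 expr0.
      rewrite big_ord_recr /= exprS.
      by move: IH; set A := \sum_(_ < _) _; set B := 2 ^+ m1; lra.
    have h1 : \sum_(n < m) roughness rho j t n y <=
        \sum_(n < m) roughness rho j t n g0 + 12 * 2 ^+ t * sg.
      apply: (@le_trans _ _ (\sum_(n < m) (roughness rho j t n g0
          + 12 * 2 ^+ t * sg * 2 ^- m * 2 ^+ n))); first exact: ler_sum.
      rewrite big_split /= lerD2l -mulr_sumr.
      apply: (le_trans (ler_wpM2l _ geom)).
        by rewrite !mulr_ge0 ?invr_ge0 ?(ltW Pm) ?(ltW Pt).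
      by rewrite divfK// lt0r_neq0.
    have h2 : \sum_(n < m) roughness rho j t n g0 <= \sum_(n < M) roughness rho j t n g0.
      by rewrite -(subnKC (ltnW mM)) big_split_ord /= lerDl sumr_ge0.
    by lra.
  have h := sum_roughness L0 hrho (leqnn (M + t + j)).
  rewrite -/(roughness_const L j t) -/sg in h.
  have N2 : 0 < N0 / 2 by rewrite divr_gt0.
  rewrite -(ler_pM2l N2).
  have -> (c : R) : N0 / 2 * (2 * sg / N0 * c) = sg * c.
    by field; exact: lt0r_neq0.
  apply: le_trans h; rewrite mulr_natr -sumr_const big_mkcond /=.
  apply: ler_sum => g _; case: ifP => [/hit//|_].
  by rewrite sumr_ge0.
Qed.

(** [T] and [delta] are fixed before [C], [rho] and [mu], so one choice serves all balls. [Z]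
    consists of points of large total roughness and of points in boxes of small measure; by
    [collapsed_box], a collapsed pair with equal codes has a member of the latter kind unless it
    meets the former. *)
Lemma bilipschitz_decomposition (L c0 kappa : R) : 0 <= L -> 0 < c0 -> 0 < kappa ->
  exists (T : finType) (delta : R), 0 < delta /\
  forall (C : R) (rho : pt -> pt -> R) (mu : {outer_measure set pt -> \bar R}),
    0 <= C -> periodic_distance L rho -> measure_diam_bound rho (c0 * C) mu ->
    exists (Z : set pt) (code : pt -> T), (mu Z <= (kappa * C)%:E)%E /\
    forall x y, unit_cube x -> unit_cube y -> ~ Z x -> ~ Z y -> code x = code y ->
      forall a, delta * `|x 0 a - y 0 a| <= rho x y.
Proof.
move=> L0 c00 kappa0.
have K0 : 0 < c0 * (2 * k%:R * (3 + L) ^+ k).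
  by rewrite !mulr_gt0// exprn_gt0// ltr_wpDr.
have [i1 hi1] := exists_pow2 (ltW K0) (divr_gt0 kappa0 (ltr0n R 2)).
have [i2 hi2] := @exists_pow2 R (3 + L) 1 (addr_ge0 (ler0n _ 3) L0) ltr01.
pose i := (i1 + i2)%N.
have le_pow2 n n' (A B : R) : 0 <= A -> (n <= n')%N -> A * 2 ^- n <= B -> A * 2 ^- n' <= B.
  move=> A0 nn'; apply: le_trans; rewrite ler_wpM2l// lef_pV2 ?posrE ?pow2_gt0//.
  by rewrite ler_weXn2l ?ler1n.
have hi3 : c0 * (2 * k%:R * (3 + L) ^+ k * 2 ^- i) <= kappa / 2.
  by rewrite mulrA; apply: le_pow2 hi1; [exact: ltW|exact: leq_addr].
have hi4 : (3 + L) * 2 ^- i <= 1.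
  by apply: le_pow2 hi2; [rewrite addr_ge0|exact: leq_addl].
(* [2 ^+ i.+1 * eta] is [2 ^- i], as [collapsed_box] requires. The collapse of the pair and the
   three terms of [flatness_error] receive a quarter of [eta] each. *)
pose eta : R := 2 ^- (i.*2.+1).
have eta0 : 0 < eta by rewrite invr_gt0 pow2_gt0.
have eta4 : 0 < eta / 4 by rewrite divr_gt0.
have [j hj] := exists_pow2 (mulr_ge0 (ler0n _ 6) L0) eta4.
have [t ht] := exists_pow2 (mulr_ge0 (ler0n _ 4) L0) eta4.
pose e : R := eta / (16 * t.+1%:R).
have e0 : 0 < e by rewrite divr_gt0// mulr_gt0.
have he : 4 * t%:R * e <= eta / 4.
  have t1 : 0 < t.+1%:R :> R by [].
  have -> : 4 * t%:R * e = eta / 4 * (t%:R / t.+1%:R).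
    by rewrite /e; field; rewrite lt0r_neq0.
  by rewrite ger_pMr// ler_pdivrMr// mul1r ler_nat.
have herr : eta / 4 + flatness_error L j t e <= eta.
  by rewrite /flatness_error; lra.
have Pi := pow2_gt0 R i.
have heta : 2 ^+ i.+1 * eta <= 2 ^- i.
  by rewrite /eta -addnn -addSn exprD invfM mulrA divff ?mul1r// lt0r_neq0// pow2_gt0.
pose sg := roughness_const L j t.
have sg0 : 0 <= sg by rewrite mulr_ge0 ?exprn_ge0.
(* The summands provide, in order, for the loss in passing to the grid, the levels below [i], a
   rough set of measure at most [kappa / 2 * C], and positivity. *)
pose A := 2 * (12 * 2 ^+ t * sg) + sg * i%:R +
  c0 * (L + 1) ^+ k * (2 * sg) * (2 / kappa) + 1.
have A1 : 0 <= 2 * (12 * 2 ^+ t * sg) by rewrite !mulr_ge0// ltW// pow2_gt0.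
have A2 : 0 <= sg * i%:R by rewrite mulr_ge0.
have A3 : 0 <= c0 * (L + 1) ^+ k * (2 * sg) * (2 / kappa).
  by rewrite !mulr_ge0 ?exprn_ge0 ?addr_ge0 ?invr_ge0// ltW.
have A0 : 0 < A by rewrite /A; lra.
have Lam0 : 0 <= 12 * 2 ^+ t * sg by rewrite !mulr_ge0// ltW// pow2_gt0.
(* The offset is [t + i] because flatness from scale [n] governs boxes of side [2 ^- (n + t)], and
   the walk in such a box has steps smaller by [2 ^- i]. *)
have [T hT] := @separating_code R k (12 * 2 ^+ t * sg) (e ^+ 2) A (t + i) Lam0
  (exprn_gt0 2 e0).
exists T, (eta / 4); split => // C rho mu C0 hrho hmu.
have S0 := roughness_ge0 hrho j t.
have [|code hcode] := hT (roughness rho j t) S0.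
  move=> n x y d d0 xy; have := roughness_lip L0 hrho j t n d0 xy.
  suff -> : 12 * L ^+ 2 * 2 ^+ t * (#|net k j| * #|net k j| * t)%:R * 2 ^+ n * d
         = 12 * 2 ^+ t * sg * 2 ^+ n * d :> R by [].
  by rewrite /sg /roughness_const; set N := _%:R; ring.
pose Z1 : set pt := [set x | unit_cube x /\ exists m, exists2 y, box m (cell m x) y &
        A < \sum_(n < m) roughness rho j t n y].
pose small m c := (mu (box m c) <= ((kappa / 2 * C) * (2 ^- m) ^+ k)%:E)%E.
pose Z2 : set pt := [set x | unit_cube x /\ exists m, small m (cell m x)].
exists (Z1 `|` Z2), code; split.
  apply: (le_trans (outer_measureU2 mu Z1 Z2)).
  have -> : kappa * C = kappa / 2 * C + kappa / 2 * C * 1 by field.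
  rewrite EFinD; apply: leeD.
    have Li : (L + 1) * 2 ^- i <= 1.
      by apply: le_trans hi4; rewrite ler_wpM2r ?invr_ge0 ?(ltW Pi)//; lra.
    apply: (le_trans (rough_set L0 hrho _ hmu A0 Li _ _)).
    - by rewrite mulr_ge0// ltW.
    - by rewrite /A -/sg; lra.
    - by rewrite /A -/sg; lra.
    - rewrite lee_fin -/sg.
      have -> : c0 * C * (L + 1) ^+ k * (2 * sg / A) =
          (c0 * (L + 1) ^+ k * (2 * sg) * (2 / kappa)) / A * (kappa / 2) * C.
        by field; rewrite !lt0r_neq0.
      rewrite ler_wpM2r// ler_piMl ?divr_ge0 ?(ltW kappa0)//.
      by rewrite ler_pdivrMr// mul1r /A; lra.
  (* These boxes are small in measure by definition, so the trivial proportion 1 suffices. *)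
  apply: (@stopping_boxes R k mu small (kappa / 2 * C) 1).
  - by rewrite mulr_ge0// divr_ge0// ltW.
  - by [].
  - by move=> M; exists M => //; rewrite mul1r ler_nat max_card.
move=> x y x1 y1 nZx nZy cxy.
have [->|/eqP xy] := eqVneq x y.
  by move=> a; rewrite subrr normr0 mulr0 (rho_ge0 hrho).
have bound z : unit_cube z -> ~ (Z1 `|` Z2) z ->
    forall m, \sum_(n < m) roughness rho j t n z <= A.
  move=> z1 nZ m; rewrite leNgt; apply/negP => Az; apply: nZ; left.
  by split => //; exists m; exists z => //; exact: box_cell.
have [n [xyn [a0 nd] flat]] := hcode x y x1 y1 (bound x x1 nZx) (bound y y1 nZy) cxy xy.
have main u v : unit_cube u -> ~ (Z1 `|` Z2) u -> close (2 ^- (n + (t + i))) u v ->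
    2 ^- (n + (t + i)).+1 < `|u 0 a0 - v 0 a0| ->
    roughness rho j t n u < e ^+ 2 -> eta / 4 * 2 ^- (n + t) < rho u v.
  move=> u1 nZ uv uva flatu; rewrite ltNge; apply/negP => ruv.
  apply: nZ; right; split => //; exists (n + t)%N.
  have uvt : close (2 ^- (n + t)) u v.
    move=> a; apply: (le_trans (uv a)); rewrite lef_pV2 ?posrE ?pow2_gt0//.
    by rewrite ler_weXn2l ?ler1n// addnA leq_addr.
  have coll := flat_collapse hrho (ltW e0) (ltW flatu) uvt ruv.
  have bu := box_cell (n + t) u1.
  have step p : box (n + t) (cell (n + t) u) p ->
      rho p (p + (v - u)) <= eta * 2 ^- (n + t).
    move=> hp; apply: (le_trans (coll p (box_close hp bu))).
    by rewrite ler_wpM2r ?invr_ge0 ?(ltW (pow2_gt0 _ _)).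
  have vu0 : close (2 ^- (n + t + i)) (v - u) 0.
    by move=> a; rewrite !mxE subr0 distrC -addnA; exact: uv.
  have vua : exists a, 2 ^- (n + t + i.+1) < `|(v - u) 0 a|.
    by exists a0; rewrite !mxE distrC addnS -addnA.
  apply: (le_trans (collapsed_box L0 hrho hmu (ltW eta0) step vu0 vua heta hi4)).
  rewrite lee_fin ler_wpM2r ?exprn_ge0 ?invr_ge0 ?(ltW (pow2_gt0 _ _))//.
  by rewrite mulrAC ler_wpM2r.
have rxy : eta / 4 * 2 ^- (n + t) < rho x y.
  case: flat => flat; first exact: main.
  rewrite (rho_sym hrho); apply: main => //; last by rewrite distrC.
  exact: closeC.
move=> a; apply: le_trans (ltW rxy); rewrite ler_wpM2l ?(ltW eta4)//.
apply: (le_trans (xyn a)); rewrite lef_pV2 ?posrE ?pow2_gt0//.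
by rewrite ler_weXn2l ?ler1n// addnA leq_addr.
Qed.

End Core.

(** * Periodic extension of a distance *)

Section Extension.
Variables (R : realType) (k : nat).
Local Notation pt := 'rV[R]_k.

Definition norm1 (x : pt) : R := \sum_a `|x 0 a|.

Lemma norm1_ge0 x : 0 <= norm1 x. Proof. exact: sumr_ge0. Qed.

Lemma norm1D x y : norm1 (x + y) <= norm1 x + norm1 y.
Proof.
by rewrite /norm1 -big_split; apply: ler_sum => a _; rewrite mxE ler_normD.
Qed.

Lemma norm1N x : norm1 (- x) = norm1 x.
Proof. by apply: eq_bigr => a _; rewrite mxE normrN. Qed.

Lemma norm1_close t x y : close t x y -> norm1 (x - y) <= k%:R * t.
Proof.
move=> xy; rewrite mulr_natl -[X in _ *+ X]card_ord -sumr_const.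
by apply: ler_sum => a _; rewrite !mxE.
Qed.

Lemma norm_le_sub_int (s z : R) : `|s| <= 2^-1 -> z \is a Num.int ->
  `|s| <= `|s - z|.
Proof.
move=> s1 /intrP[[n|n] ->].
  case: n => [|n]; first by rewrite subr0.
  have n1 : 1 <= (n.+1%:Z)%:~R :> R by rewrite -pmulrn ler1n.
  move: s1 n1; set N := _%:~R => s1 n1.
  have : N - s <= `|s - N| by rewrite -opprB ler_normr lexx orbT.
  by move: s1; rewrite !ler_norml => /andP[? ?] ?; apply/andP; split; lra.
rewrite NegzE; have n1 : 1 <= (n.+1%:Z)%:~R :> R by rewrite -pmulrn ler1n.
rewrite mulrNz opprK; move: s1 n1; set N := _%:~R => s1 n1.
have : s + N <= `|s + N| by rewrite ler_norm.
by move: s1; rewrite !ler_norml => /andP[? ?] ?; apply/andP; split; lra.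
Qed.

Lemma norm1_sub_int x z : close 2^-1 x 0 -> integral_vec z ->
  norm1 x <= norm1 (x - z).
Proof.
move=> x1 hz; apply: ler_sum => a _; rewrite !mxE; apply: norm_le_sub_int => //.
by have := x1 a; rewrite mxE subr0.
Qed.

(** The McShane extension, for [norm1], of the periodic copy of [phi] on the integral translates of
    [A]. *)
Definition periodic_extension (L : R) (A : set pt) (phi : pt -> R) (x : pt) : R :=
  inf [set w | exists a z,
    [/\ A a, integral_vec z & w = phi a + L * norm1 (x - a - z)]].

Section PeriodicExtension.
Variables (L : R) (A : set pt) (phi : pt -> R).
Hypotheses (L0 : 0 <= L) (A0 : A !=set0) (phi0 : forall a, 0 <= phi a).
Hypothesis phi_lip :
  forall a b, A a -> A b -> phi a <= phi b + L * norm1 (a - b).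
Hypothesis A_half : forall a b, A a -> A b -> close 2^-1 a b.

Lemma integral_vec0 : integral_vec (0 : pt).
Proof. by move=> a; rewrite mxE rpred0. Qed.

Let vals x := [set w | exists a z,
    [/\ A a, integral_vec z & w = phi a + L * norm1 (x - a - z)]].

Let vals_neq0 x : vals x !=set0.
Proof.
by have [a Aa] := A0; exists (phi a + L * norm1 (x - a - 0)), a, 0; split => //;
  exact: integral_vec0.
Qed.

Let vals_lb x : has_lbound (vals x).
Proof.
by exists 0 => _ [a [z [Aa hz ->]]]; rewrite addr_ge0// mulr_ge0// norm1_ge0.
Qed.

Lemma periodic_extension_periodic : periodic (periodic_extension L A phi).
Proof.
move=> x w hw; rewrite /periodic_extension; congr inf; apply/seteqP.
split => _ [a [z [Aa hz ->]]]; exists a.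
  exists (z - w); split => //; first by move=> b; rewrite !mxE rpredB.
  by congr (_ + _ * norm1 _); apply/rowP => b; rewrite !mxE; ring.
exists (z + w); split => //; first by move=> b; rewrite !mxE rpredD.
by congr (_ + _ * norm1 _); apply/rowP => b; rewrite !mxE; ring.
Qed.

Lemma periodic_extension_lip x y :
  periodic_extension L A phi x <= periodic_extension L A phi y + L * norm1 (x - y).
Proof.
rewrite -lerBlDr; apply: lb_le_inf; first exact: vals_neq0.
move=> _ [a [z [Aa hz ->]]]; rewrite lerBlDr.
apply: (@le_trans _ _ (phi a + L * norm1 (x - a - z))).
  by apply: (ge_inf (vals_lb x)); exists a, z.
suff : L * norm1 (x - a - z) <= L * (norm1 (y - a - z) + norm1 (x - y)) by lra.
rewrite ler_wpM2l//; have -> : x - a - z = (y - a - z) + (x - y).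
  by apply/rowP => b; rewrite !mxE; ring.
exact: norm1D.
Qed.

(** Points of [A] differ by at most 1/2 in each coordinate, so no integral translate of [b] is
    closer to [a] than [b] itself, and [phi_lip] concludes. *)
Lemma periodic_extensionE a : A a -> periodic_extension L A phi a = phi a.
Proof.
move=> Aa; apply/eqP; rewrite eq_le; apply/andP; split.
  apply: (ge_inf (vals_lb a)); exists a, 0; split => //; first exact: integral_vec0.
  by rewrite subrr subr0 /norm1 big1 ?mulr0 ?addr0// => b _; rewrite mxE normr0.
apply: lb_le_inf; first exact: vals_neq0.
move=> _ [b [z [Ab hz ->]]]; apply: (le_trans (phi_lip Aa Ab)).
rewrite lerD2l ler_wpM2l//; apply: norm1_sub_int => // c.
by have := A_half Aa Ab c; rewrite !mxE subr0.
Qed.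

End PeriodicExtension.

(* A Kuratowski embedding in disguise: each function [dist m (g a)] is extended
   periodically, and the distance is the supremum of the differences. *)
Lemma periodic_distance_extension (M : Type) (dist : M -> M -> R) (L : R)
    (A : set pt) (g : pt -> M) : 0 <= L -> A !=set0 ->
  (forall m m', 0 <= dist m m') -> (forall m, dist m m = 0) ->
  (forall m m', dist m m' = dist m' m) ->
  (forall m1 m2 m3, dist m1 m3 <= dist m1 m2 + dist m2 m3) ->
  (forall a b, A a -> A b -> dist (g a) (g b) <= L * norm1 (a - b)) ->
  (forall a b, A a -> A b -> close 2^-1 a b) ->
  exists2 rho, periodic_distance (L * k%:R) rho &
    forall a b, A a -> A b -> rho a b = dist (g a) (g b).
Proof.
move=> L0 A0 d0 dxx dC dtri glip Ahalf.
pose F m := periodic_extension L A (fun a => dist m (g a)).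
have Flip m x y : `|F m x - F m y| <= L * norm1 (x - y).
  have phi_lip a b : A a -> A b -> dist m (g a) <= dist m (g b) + L * norm1 (a - b).
    move=> Aa Ab; apply: (le_trans (dtri m (g b) (g a))).
    by rewrite lerD2l dC; exact: glip.
  have e1 := periodic_extension_lip L0 A0 (fun a => d0 m (g a)) x y.
  have e2 := periodic_extension_lip L0 A0 (fun a => d0 m (g a)) y x.
  rewrite -opprB norm1N in e2; rewrite -/(F m) in e1 e2.
  by rewrite ler_norml; apply/andP; split; lra.
pose V x y := [set w | exists m, w = `|F m x - F m y|].
have Vub x y : has_ubound (V x y) by exists (L * norm1 (x - y)) => _ [m ->].
have Vn0 x y : V x y !=set0 by exists `|F (g x) x - F (g x) y|, (g x).
have le_sup x y m : `|F m x - F m y| <= sup (V x y).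
  by apply: (ub_le_sup (Vub x y)); exists m.
exists (fun x y => sup (V x y)).
  split.
  - by move=> x y; apply: le_trans (le_sup x y (g x)).
  - move=> x y; congr sup; apply/seteqP.
    by split => _ [m ->]; exists m; rewrite distrC.
  - move=> y x z; apply: ge_sup; first exact: Vn0.
    move=> _ [m ->]; apply: le_trans (lerD (le_sup x y m) (le_sup y z m)).
    by rewrite -[F m x - F m z](subrKA (F m y)) ler_normD.
  - move=> t x y xy; apply: ge_sup; first exact: Vn0.
    move=> _ [m ->]; apply: (le_trans (Flip m x y)).
    by rewrite -mulrA ler_wpM2l// norm1_close.
  - move=> x y z hz; congr sup; apply/seteqP.
    by split => _ [m ->]; exists m; rewrite /F periodic_extension_periodic.
move=> a b Aa Ab.
have FE m c : A c -> F m c = dist m (g c).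
  move=> Ac; apply: periodic_extensionE => // x y Ax Ay.
  apply: (le_trans (dtri m (g y) (g x))).
  by rewrite lerD2l dC; exact: glip.
apply/eqP; rewrite eq_le; apply/andP; split.
  apply: ge_sup; first exact: Vn0.
  move=> _ [m ->]; rewrite !FE// ler_norml; apply/andP; split.
    by have := dtri m (g a) (g b); lra.
  by have := dtri m (g b) (g a); rewrite (dC (g b)); lra.
apply: le_trans (le_sup a b (g b)); rewrite !FE// dxx subr0 dC.
exact: ler_norm.
Qed.

End Extension.

(** * Back to the metric space *)

Section EuclideanNorm.
Variables (R : realType) (k : nat).
Implicit Types v : 'rV[R]_k.

Lemma euclidean_norm_ge_coord v a : `|v 0 a| <= euclidean_norm v.
Proof.
rewrite /euclidean_norm -sqrtr_sqr ler_wsqrtr// (bigD1 a)//= lerDl.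
by rewrite sumr_ge0// => b _; rewrite sqr_ge0.
Qed.

Lemma euclidean_norm_le_norm1 v : euclidean_norm v <= norm1 v.
Proof.
rewrite /euclidean_norm -[leRHS]ger0_norm ?norm1_ge0// -sqrtr_sqr ler_wsqrtr//.
have -> : \sum_(i < k) v ord0 i ^+ 2 = \sum_(i < k) `|v 0 i| ^+ 2.
  by apply: eq_bigr => a _; rewrite real_normK ?num_real.
rewrite [norm1 v ^+ 2]expr2 /norm1 [X in _ <= X * _](eq_bigr (fun a => `|v 0 a|))// mulr_suml.
apply: ler_sum => a _; rewrite expr2 ler_wpM2l//.
by rewrite (bigD1 a)//= lerDl sumr_ge0.
Qed.

Lemma norm1Z (c : R) v : norm1 (c *: v) = `|c| * norm1 v.
Proof. by rewrite /norm1 mulr_sumr; apply: eq_bigr => a _; rewrite mxE normrM. Qed.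

Lemma euclidean_norm_ge0 v : 0 <= euclidean_norm v.
Proof. exact: sqrtr_ge0. Qed.

End EuclideanNorm.

Section Rescaling.
Variables (R : realType) (k : nat).
Local Notation pt := 'rV[R]_k.

(* Carries the ball of radius [r] into the cube of side 1/2, so that distances
   within its image are the same as on the unit torus. *)
Definition to_cube (r : R) (u : pt) : pt := (4 * r)^-1 *: u + const_mx 4^-1.

Definition of_cube (r : R) (x : pt) : pt := (4 * r) *: (x - const_mx 4^-1).

Lemma to_cubeK r : 0 < r -> cancel (to_cube r) (of_cube r).
Proof.
move=> r0 u; rewrite /of_cube /to_cube addrK scalerA divff ?scale1r//.
by rewrite lt0r_neq0// mulr_gt0.
Qed.

Lemma of_cubeB r x y : of_cube r x - of_cube r y = (4 * r) *: (x - y).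
Proof. by rewrite /of_cube -scalerBr; congr (_ *: _); apply/rowP => a; rewrite !mxE; ring. Qed.

Lemma of_cube_ball r x a : 0 < r -> euclidean_ball 0 r (of_cube r x) ->
  0 <= x 0 a <= 2^-1.
Proof.
move=> r0 hx; have := le_lt_trans (euclidean_norm_ge_coord _ a) hx.
rewrite subr0 !mxE normrM (ger0_norm (mulr_ge0 (ler0n _ 4) (ltW r0))).
rewrite -ltr_pdivlMl ?mulr_gt0//.
have -> : (4 * r)^-1 * r = 4^-1 by field; exact: lt0r_neq0.
by rewrite ltr_norml => /andP[? ?]; apply/andP; split; lra.
Qed.

End Rescaling.

(** The image of a set of small [rho]-diameter lies in the ball of radius [d * r] about any of its
    points. *)
Lemma image_measure_diam_bound (R : realType) (k : nat) (M : metricType R)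
    (c0 r : R) (A : set 'rV[R]_k.+1) (g : 'rV[R]_k.+1 -> M) rho :
  0 < c0 -> 0 < r ->
  (forall (x : M) (s : R), 0 < s <= r ->
     (hausdorff_measure k.+1 (ball x s) <= (c0 * s ^+ k.+1)%:E)%E) ->
  (forall x y, A x -> A y -> rho x y = mdist (g x) (g y) / r) ->
  measure_diam_bound rho (c0 * r ^+ k.+1)
    (image_measure (@hausdorff_measure R M k.+1) A g).
Proof.
move=> c00 r0 hball hrho X d /andP[d0 d1] hX.
have [[p [Ap Xp]]|no] := pselect (exists p, A p /\ X p); last first.
  rewrite /image_measure (_ : A `&` X = set0) ?image_set0 ?outer_measure0.
    by rewrite lee_fin !mulr_ge0 ?exprn_ge0// ltW.
  by apply/seteqP; split => // p [Ap Xp]; case: no; exists p.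
apply: (@le_trans _ _ (hausdorff_measure k.+1 (ball (g p) (d * r)))).
  apply: le_outer_measure => _ [q [Aq Xq] <-]; rewrite ballEmdist/=.
  by have := hX p q Xp Xq; rewrite hrho// ltr_pdivrMr.
apply: (le_trans (hball _ _ _)).
  by rewrite mulr_gt0//= ler_piMl// ltW.
by rewrite lee_fin exprMn [d ^+ _ * _]mulrC mulrA.
Qed.

Theorem corollary1p2 (R : realType) (k : nat) (M : metricType R)
  (hk : (0 < k)%N)
  (hreg : ahlfors_david_regular k M)
  (hlip : big_pieces_lipschitz k M) :
  big_pieces_bilipschitz k M.
Proof.
case: k hk hreg hlip => // k' _ [c0 [c00 hreg]] [L1 [c1 [L10 c10 hlip]]].
set k := k'.+1 in hreg hlip *.
(* Points are rescaled by [4 * r] and distances by [r], which turns [L1] into [4 * L1]; the factor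
   [k] compares [norm1] with the sup norm. *)
have L0 : 0 <= 4 * L1 * k%:R by rewrite !mulr_ge0// ltW.
have [T [delta [delta0 hT]]] :=
  bilipschitz_decomposition k' L0 c00 (divr_gt0 c10 (ltr0n R 2)).
(* [L1] serves the upper bound, and [4 * k / delta], with the rescaling undone, the lower one. *)
pose L2 := L1 + 4 * k%:R / delta.
have kd0 : 0 < 4 * k%:R / delta by rewrite divr_gt0// mulr_gt0.
have L20 : 0 < L2 by rewrite addr_gt0.
(* Half of [c1] remains after [Z] is removed and is shared among the codes; the successor makes the
   pigeonhole inequality strict. *)
pose c2 := c1 / 2 / #|T|.+1%:R.
have c20 : 0 < c2 by rewrite !divr_gt0.
exists L2, c2; split => // x0 r r0 rdiam.
have [A [f [Ar flip hf]]] := hlip x0 r r0 rdiam.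
have rk0 : 0 < r ^+ k by rewrite exprn_gt0.
pose g x := f (of_cube r x); pose A' : set 'rV[R]_k := [set x | A (of_cube r x)].
have A'0 : A' !=set0.
  apply/set0P/eqP => A'E.
  have AE : A = set0.
    apply/seteqP; split => // u Au.
    have : A' (to_cube r u) by rewrite /A' /= to_cubeK.
    by rewrite A'E.
  move: hf; rewrite AE image_set0 set0I outer_measure0 lee_fin leNgt.
  by rewrite mulr_gt0.
have A'cube x : A' x -> forall a, 0 <= x 0 a <= 2^-1.
  by move=> A'x a; apply: (of_cube_ball _ r0); exact: Ar.
have r40 : 0 < 4 * r by rewrite mulr_gt0.
have [|||||||rho hrho rhoE] := @periodic_distance_extension R k M
    (fun m m' => mdist m m' / r) (4 * L1) A' g _ A'0.
- by rewrite mulr_ge0// ltW.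
- by move=> m m'; rewrite divr_ge0 ?mdist_ge0// ltW.
- by move=> m; rewrite mdistxx mul0r.
- by move=> m m'; rewrite metric_sym.
- by move=> m1 m2 m3; rewrite -mulrDl ler_pM2r ?invr_gt0// metric_triangle.
- move=> a b A'a A'b; rewrite ler_pdivrMr//.
  apply: (le_trans (flip _ _ A'a A'b)).
  rewrite of_cubeB.
  apply: (le_trans (ler_wpM2l (ltW L10) (euclidean_norm_le_norm1 _))).
  rewrite norm1Z (ger0_norm (ltW r40)).
  by rewrite le_eqVlt; apply/orP; left; apply/eqP; ring.
- move=> a b A'a A'b c; have /andP[? ?] := A'cube a A'a c.
  by have /andP[? ?] := A'cube b A'b c; rewrite ler_norml; apply/andP; split; lra.
have hmu : measure_diam_bound rho (c0 * r ^+ k)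
    (image_measure (@hausdorff_measure R M k) A' g).
  apply: image_measure_diam_bound => // x s /andP[s0 sr].
  have sd : (s%:E < diam [set: M])%E by apply: le_lt_trans rdiam; rewrite lee_fin.
  by have /andP[] := hreg x s s0 sd.
have [Z [code [muZ hcode]]] := hT (r ^+ k) rho
  (image_measure (@hausdorff_measure R M k) A' g) (ltW rk0) hrho hmu.
pose B (tau : T) : set 'rV[R]_k :=
  [set u | [/\ A u, ~ Z (to_cube r u) & code (to_cube r u) = tau]].
(* Pigeonhole: within the ball, the image of [A] is covered by that of [Z] and those of the pieces
   [B tau]. *)
have [tau htau] : exists tau, ((c2 * r ^+ k)%:E <=
    hausdorff_measure k ((f @` B tau) `&` ball x0 r))%E.
  apply: contrapT => /forallNP small.
  pose Q : set M := [set m | exists tau, ((f @` B tau) `&` ball x0 r) m].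
  have cover : (f @` A) `&` ball x0 r `<=` (g @` (A' `&` Z)) `|` Q.
    move=> m [[u Au <-] um]; have [Zu|nZu] := pselect (Z (to_cube r u)).
      left; exists (to_cube r u); last by rewrite /g to_cubeK.
      by split => //; rewrite /A' /= to_cubeK.
    by right; exists (code (to_cube r u)); split => //; exists u.
  have := le_trans hf (le_outer_measure (@hausdorff_measure R M k) _ _ cover).
  move=> /le_trans/(_ (outer_measureU2 (@hausdorff_measure R M k) _ _)).
  have Qsum := @outer_measure_fin_subadditive _ _ _
    (@hausdorff_measure R M k) Q _ (fun m Qm => Qm).
  move=> /le_trans/(_ (leeD (lexx _) Qsum)); apply/negP; rewrite -ltNge.
  apply: (@le_lt_trans _ _ ((c1 / 2 * r ^+ k)%:E + \sum_(tau : T) (c2 * r ^+ k)%:E)%E).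
    apply: leeD; first exact: muZ.
    apply: lee_sum => tau _; apply: ltW; rewrite ltNge; apply/negP; exact: small.
  rewrite sumEFin -EFinD lte_fin sumr_const -mulrnAl -mulrDl ltr_pM2r// -[c2 *+ _]mulr_natr.
  have T0 : 0 < #|T|.+1%:R :> R by [].
  suff : c2 * #|T|%:R < c1 / 2 by lra.
  by rewrite /c2 mulrAC ltr_pdivrMr// ltr_pM2l ?divr_gt0// ltr_nat.
exists (B tau), f; split => //; first by move=> u [Au _ _]; exact: Ar.
move=> u v [Au nZu cu] [Av nZv cv]; have d0 := mdist_ge0 (f u) (f v).
have N0 := euclidean_norm_ge0 (u - v).
have A'u : A' (to_cube r u) by rewrite /A' /= to_cubeK.
have A'v : A' (to_cube r v) by rewrite /A' /= to_cubeK.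
have unit x : A' x -> unit_cube x.
  move=> A'x a; have /andP[-> h] := A'cube x A'x a.
  by apply: le_lt_trans h _; rewrite invf_lt1// ltr1n.
apply/andP; split; last first.
  apply: (le_trans (flip u v Au Av)); rewrite ler_wpM2r// lerDl.
  exact: ltW.
rewrite ler_pdivrMl//.
apply: (@le_trans _ _ (4 * k%:R / delta * mdist (f u) (f v))); last first.
  by rewrite ler_wpM2r// lerDr ltW.
apply: (le_trans (euclidean_norm_le_norm1 _)).
have -> : u - v = (4 * r) *: (to_cube r u - to_cube r v).
  by rewrite -of_cubeB !to_cubeK.
rewrite norm1Z (ger0_norm (ltW r40)).
have hclose : close (delta^-1 * (mdist (f u) (f v) / r)) (to_cube r u) (to_cube r v).
  move=> a; rewrite ler_pdivlMl//.
  have := hcode _ _ (unit _ A'u) (unit _ A'v) nZu nZv (etrans cu (esym cv)) a.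
  by rewrite rhoE// /g !to_cubeK.
apply: (le_trans (ler_wpM2l (ltW r40) (norm1_close hclose))).
rewrite le_eqVlt; apply/orP; left; apply/eqP; field.
by rewrite !lt0r_neq0.
Qed.
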